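(* Let $k$ be a fixed positive integer and $\varepsilon>0$ be fixed. There is $p_0(\varepsilon,k)$ such that the following holds for every prime $p>p_0(\varepsilon,k)$. Let $\mathcal{I}$ and $\mathcal{J}$ be nonzero intervals of $\mathbb{F}_p$ such that $$|\mathcal{I}|\cdot|\mathcal{J}|^{2k/(k+1)}>p^{1+\varepsilon}.$$ Then for every $\lambda\in\mathbb{F}_p$ the equation $$\sum_{i=1}^{4k}\frac{x_i}{y_i}=\lambda$$ has a solution with $(x_1,\dots,x_{4k})\in\mathcal{I}^{4k}$ and $(y_1,\dots,y_{4k})\in\mathcal{J}^{4k}$ (with all $y_i\neq0$).
   Context: $\mathbb{F}_p$ is the field of residues modulo the prime $p$. An interval of $\mathbb{F}_p$ is a set of the form $\{a,a+1,\dots,a+N-1\}$ (residues mod $p$) for some $a\in\mathbb{F}_p$ and integer $1\le N\le p$; it is called nonzero if it is not equal to $\{0\}$. $|\mathcal{X}|$ denotes cardinality. The fraction $x/y$ means $x\cdot y^{-1}$ in $\mathbb{F}_p$, so only $y\neq 0$ is allowed. Here $\varepsilon$ is a small fixed positive constant and $p$ is sufficiently large in terms of $\varepsilon$ (and the fixed constant $k$). *)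

(* Defs.v *)
From mathcomp Require Import all_boot all_order all_algebra.

Set Implicit Arguments.
Unset Strict Implicit.
Unset Printing Implicit Defensive.

Import GRing.Theory.
Local Open Scope ring_scope.

(* 'F_p is the integers modulo pdiv p: these notions are only meaningful for
   p prime. *)
Definition is_interval (p : nat) (A : {set 'F_p}) : Prop :=
  exists (a : 'F_p) (N : nat),
    (1 <= N <= p)%N /\ A = [set a + i%:R | i : 'I_N].

Definition is_nonzero_interval (p : nat) (A : {set 'F_p}) : Prop :=
  is_interval A /\ A <> [set 0].

(* Main.v *)
Require Import Defs.
From mathcomp Require Import all_boot all_order all_algebra algC zify ring lra.
From mathcomp Require Import reals exp trigo complex.

(* Write J = {a, a+1, ..., a+N-1} and fix U, V with U V comparable to N. For a ratio
   b = (a+i)/u with u <= U one has 1/(a + i + u v) = u^-1 / (b + v), so sums of k reciprocals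
   of elements of J contain u^-1 A_b, where A_b is the set of the sums of 1/(b+v) over k-subsets
   of {1, ..., V}. Two distinct k-subsets give equal sums for at most 2k values of b, and there are
   about min(N U, p) ratios b, so some A_b has size about min(V^k, N U, p); the choice
   V = N^(2/(k+1)) makes this about min(N^(2k/(k+1)), p).

   It remains to write lambda as x_1 a_1 + ... + x_4 a_4 with a_i in A = A_b and x_i in a set X
   (X = I up to a dilation, or X = x_0 U_b^-1 with U_b = {u : b u in J} when A almost fills F_p).
   With S(t) = sum_(x in X, a in A) e(t x a), duality and two applications of Cauchy-Schwarz give
   sum_(t <> 0) |S(t)|^4 <= p^2 |A|^2 E(X), where E is the multiplicative energy; for an interval
   of length m <= sqrt p, E is m^2 up to logarithms. When |I| > sqrt p the same inequality is
   applied on the Fourier side to the dual interval B = [-b, b] with b about p/|I|: it yields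
   a_1, ..., a_4 in A such that no t <> 0 has all t a_i in B, and then the linear form
   x_1 a_1 + ... + x_4 a_4 takes every value on I^4. *)

Set Implicit Arguments.
Unset Strict Implicit.
Unset Printing Implicit Defensive.

Import Order.TTheory GRing.Theory Num.Theory.

(** * Counting proportional pairs in an interval *)

(** Dyadic blocks: from [2 ^ n] to [2 ^ n.+1] there are [2 ^ n] terms, each at most [U %/ 2 ^ n], so
    a block contributes at most [U]. *)
Lemma sum_divn_le U :
  \sum_(1 <= e < U.+1) U %/ e <= U * (trunc_log 2 U).+1.
Proof.
have dyadic n : \sum_(1 <= e < 2 ^ n) U %/ e <= U * n.
  elim: n => [|n IHn]; first by rewrite big_geq.
  rewrite (big_cat_nat _ (n := 2 ^ n)) ?expn_gt0 //=; last by rewrite leq_exp2l.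
  rewrite mulnS addnC; apply: leq_add => //.
  apply: (@leq_trans (\sum_(2 ^ n <= e < 2 ^ n.+1) U %/ 2 ^ n)).
    by rewrite !big_seq; apply: leq_sum => e; rewrite mem_index_iota => /andP[le_e _];
       apply: leq_div2l; rewrite ?expn_gt0.
  rewrite sum_nat_const_nat expnS mul2n -addnn addnK mulnC.
  exact: leq_trunc_div.
apply: leq_trans (dyadic _).
have U_lt : U.+1 <= 2 ^ (trunc_log 2 U).+1 by apply: trunc_log_ltn.
by rewrite (big_cat_nat _ (n := U.+1) (p := 2 ^ _)) //= leq_addr.
Qed.

Lemma sum_dvdn d n : 0 < d -> \sum_(1 <= j < n.+1) (d %| j) = n %/ d.
Proof.
move=> d_gt0; elim: n => [|n IHn]; first by rewrite big_geq // div0n.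
by rewrite big_nat_recr //= IHn divnS // addnC.
Qed.

(** For [e = u %/ gcdn u u'] the quotient [u %/ e] divides [u'], so the term is among the
    [T u u' e]. Summed over all [e], a multiple [u] of [e] admits [e + 1] values of [u'], which
    contribute at most [2 * N], and there are [U %/ e] such [u]. *)
Lemma sum_divn_gcdn N U :
  \sum_(1 <= u < U.+1) \sum_(0 <= u' < u.+1) N %/ (u %/ gcdn u u')
    <= 2 * N * U * (trunc_log 2 U).+1.
Proof.
pose T u u' e := (e %| u) * (u %/ e %| u') * (N %/ e).
have le_T u u' : 1 <= u < U.+1 ->
    N %/ (u %/ gcdn u u') <= \sum_(1 <= e < U.+1) T u u' e.
  move=> /andP[u_gt0 leuU]; set e := u %/ gcdn u u'.
  have dvd_gu : gcdn u u' %| u by apply: dvdn_gcdl.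
  have g_gt0 : 0 < gcdn u u' by rewrite gcdn_gt0 u_gt0.
  have e_gt0 : 0 < e by rewrite divn_gt0 // dvdn_leq.
  have leeU : e < U.+1 by apply: leq_ltn_trans leuU; apply: leq_div.
  rewrite (big_cat_nat _ (n := e)) //=; last exact: ltnW.
  rewrite [X in _ + X]big_ltn // {2}/T.
  have -> : e %| u by apply/dvdnP; exists (gcdn u u'); rewrite mulnC divnK.
  have -> : u %/ e = gcdn u u'.
    by rewrite -[X in X %/ e](divnK dvd_gu) -/e mulKn.
  by rewrite dvdn_gcdr !mul1n; lia.
apply: (@leq_trans (\sum_(1 <= u < U.+1) \sum_(0 <= u' < u.+1)
    \sum_(1 <= e < U.+1) T u u' e)).
  rewrite !big_seq; apply: leq_sum => u; rewrite mem_index_iota => hu.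
  by apply: leq_sum => u' _; apply: le_T.
have -> : \sum_(1 <= u < U.+1) \sum_(0 <= u' < u.+1) \sum_(1 <= e < U.+1) T u u' e
   = \sum_(1 <= e < U.+1) \sum_(1 <= u < U.+1) \sum_(0 <= u' < u.+1) T u u' e.
  by rewrite exchange_big_nat /=; under eq_bigr do rewrite exchange_big_nat.
apply: (@leq_trans (\sum_(1 <= e < U.+1) (2 * N) * (U %/ e))); last first.
  by rewrite -big_distrr /= -[X in _ <= X]mulnA leq_mul2l sum_divn_le orbT.
rewrite !big_seq; apply: leq_sum => e; rewrite mem_index_iota => /andP[e_gt0 _].
apply: (@leq_trans (\sum_(1 <= u < U.+1) (e %| u) * (2 * N))); last first.
  by rewrite -big_distrl /= sum_dvdn // mulnC.
rewrite !big_seq; apply: leq_sum => u; rewrite mem_index_iota => /andP[u_gt0 _].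
rewrite /T; have [dvd_eu|_] := boolP (e %| u); last first.
  by rewrite big1.
have d_gt0 : 0 < u %/ e by rewrite divn_gt0 // dvdn_leq.
rewrite -big_distrl /= mul1n.
under eq_bigr do rewrite mul1n.
rewrite big_ltn // dvdn0 sum_dvdn //.
have -> : u %/ (u %/ e) = e by rewrite -[X in X %/ _](divnK dvd_eu) mulKn.
have := leq_trunc_div N e; nia.
Qed.

Lemma natr_Fp_inj p (m n : nat) : prime p ->
  (m%:R = n%:R :> 'F_p)%R -> m = n %[mod p].
Proof. by move=> p_pr /(congr1 (@nat_of_ord _)); rewrite !val_Fp_nat. Qed.

Lemma subn_cross (A B X Y : nat) : A <= B -> A + X = B + Y -> B - A = X - Y.
Proof. lia. Qed.

(** The residue of the integer [i * u' + j * u] is fixed, so its quotient by [p] determines it. The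
    integer in turn fixes [i] modulo [e = u %/ gcdn u u'], so [i %/ e] determines [i], and then [j]
    follows from [0 < u]. *)
Lemma card_linear_form p N u u' (c : 'F_p) : prime p -> 0 < u ->
  #|[set ij : 'I_N * 'I_N | (ij.1 * u' + ij.2 * u)%:R == c :> 'F_p]%R|
    <= ((N * (u + u')) %/ p).+1 * (N %/ (u %/ gcdn u u')).+1.
Proof.
move=> p_pr u_gt0; set g := gcdn u u'; set K := _ %/ p; set e := u %/ g.
have dvd_gu : g %| u by apply: dvdn_gcdl.
have dvd_gu' : g %| u' by apply: dvdn_gcdr.
have g_gt0 : 0 < g by rewrite gcdn_gt0 u_gt0.
have e_gt0 : 0 < e by rewrite divn_gt0 // dvdn_leq.
have cop : coprime e (u' %/ g).
  by rewrite /coprime -(eqn_pmul2r g_gt0) muln_gcdl !divnK // mul1n.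
pose v (ij : 'I_N * 'I_N) := ij.1 * u' + ij.2 * u.
pose h ij : 'I_K.+1 * 'I_(N %/ e).+1 := (inord (v ij %/ p), inord (ij.1 %/ e)).
have v_le ij : v ij %/ p <= K.
  apply: leq_div2r; rewrite /v mulnDr addnC.
  by apply: leq_add; rewrite leq_mul2r ltnW ?orbT.
have i_le (i : 'I_N) : i %/ e <= N %/ e by apply: leq_div2r; apply: ltnW.
set S := [set _ | _].
rewrite -[K.+1]card_ord -[(N %/ e).+1]card_ord -card_prod.
apply: (@leq_trans #|h @: S|); last exact: max_card.
rewrite card_in_imset // => ij ij'; rewrite !inE => /eqP hij /eqP hij' [].
move=> /(congr1 val) /=; rewrite !inordK ?ltnS // => eq_q.
move=> /(congr1 val) /=; rewrite !inordK ?ltnS // => eq_i.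
have eq_v : v ij = v ij'.
  rewrite (divn_eq (v ij) p) (divn_eq (v ij') p) eq_q; congr addn.
  by apply: (@natr_Fp_inj p) => //; rewrite hij hij'.
(* Divided by the gcd, the coefficients [e] and [u' %/ g] are coprime, so [e] divides the difference
   of the two indices. *)
have modi (i j : nat) x y : i <= j ->
    i * u' + x * u = j * u' + y * u -> i = j %[mod e].
  move=> leij eq_ij; apply/esym/eqP; rewrite eqn_mod_dvd //.
  rewrite -(Gauss_dvdl _ cop).
  have : (i * (u' %/ g) + x * e = j * (u' %/ g) + y * e).
    by apply/eqP; rewrite -(eqn_pmul2r g_gt0) !mulnDl -!mulnA !divnK // eq_ij.
  move=> E; apply/dvdnP; exists (x - y); rewrite !mulnBl.
  by apply: subn_cross; rewrite ?leq_mul.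
have eq1 : ij.1 = ij'.1.
  apply: val_inj; rewrite /= (divn_eq ij.1 e) (divn_eq ij'.1 e) eq_i; congr addn.
  have /orP[le|le] := leq_total ij.1 ij'.1; first exact: modi eq_v.
  by apply/esym; apply: modi (esym eq_v).
have eq2 : ij.2 = ij'.2.
  apply: val_inj; move: eq_v; rewrite /v eq1 => /addnI /eqP.
  by rewrite eqn_pmul2r // => /eqP.
by rewrite [ij]surjective_pairing [ij']surjective_pairing eq1 eq2.
Qed.

(** By symmetry [u] is the larger coefficient. With the minus sign this is a linear congruence with
    nonnegative coefficients; with the plus sign, reversing the second index makes it one. *)
Lemma card_proportional p N (a : 'F_p) (s : bool) u u' : prime p ->
  0 < maxn u u' ->
  #|[set ij : 'I_N * 'I_N |
      (a + ij.1%:R) * u'%:R == (-1) ^+ s * ((a + ij.2%:R) * u%:R)]%R|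
    <= ((N * (u + u')) %/ p).+1 * (N %/ (maxn u u' %/ gcdn u u')).+1.
Proof.
move=> p_pr; wlog leu : u u' / u' <= u => [wlog_le|].
  have /orP[le|le] := leq_total u' u; first exact: wlog_le.
  rewrite maxnC gcdnC [u + u']addnC => /(wlog_le _ _ le); apply: leq_trans.
  have swap_inj : injective (fun ij : 'I_N * 'I_N => (ij.2, ij.1)).
    by move=> [i j] [i' j'] [-> ->].
  rewrite -(card_imset _ swap_inj).
  apply/subset_leq_card/subsetP => _ /imsetP[[i j] hij ->].
  move: hij; rewrite !inE /= => /eqP ->.
  by rewrite mulrA -signr_addb addbb mul1r.
rewrite (maxn_idPl leu) => u_gt0.
case: s.
  apply: leq_trans (card_linear_form N u' (- (a * (u + u')%:R))%R p_pr u_gt0).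
  apply/subset_leq_card/subsetP => -[i j]; rewrite !inE /= => /eqP E.
  rewrite -subr_eq0; apply/eqP; rewrite natrD !natrM natrD.
  have : ((a + i%:R) * u'%:R + (a + j%:R) * u%:R = 0)%R by rewrite E; ring.
  by move=> <-; ring.
apply: leq_trans (card_linear_form N u' ((N.-1%:R + a) * u%:R - a * u'%:R)%R p_pr u_gt0).
pose h (ij : 'I_N * 'I_N) := (ij.1, rev_ord ij.2).
have h_inj : injective h.
  by move=> [i j] [i' j'] E; congr pair; [case: E | apply/rev_ord_inj/val_inj; case: E].
rewrite -(card_imset _ h_inj).
apply/subset_leq_card/subsetP => _ /imsetP[[i j] hij ->].
move: hij; rewrite !inE /= expr0 mul1r => /eqP E.
have -> : N - j.+1 = N.-1 - j by rewrite -subn1 -subnDA add1n.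
have lej : j <= N.-1 by have := ltn_ord j; lia.
rewrite -subr_eq0; apply/eqP; rewrite natrD !natrM natrB //.
have : ((a + i%:R) * u'%:R - (a + j%:R) * u%:R = 0)%R by rewrite E; ring.
by move=> <-; ring.
Qed.

(** The triangle [u' <= u] and its mirror image cover the square. On each, [sum_divn_gcdn] bounds
    the quotients and [U <= N] absorbs the added ones. *)
Lemma sum_divn_maxn_gcdn N U : U <= N ->
  \sum_(0 <= u < U.+1) \sum_(0 <= u' < U.+1 | 0 < maxn u u')
      (N %/ (maxn u u' %/ gcdn u u')).+1
    <= 4 * N * U * (trunc_log 2 U).+2.
Proof.
move=> leUN; set F := fun u u' => (N %/ (u %/ gcdn u u')).+1.
pose T u u' := (0 < u) * (u' <= u) * F u u'.
have T_sum : \sum_(0 <= u < U.+1) \sum_(0 <= u' < U.+1) T u u'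
    <= 2 * N * U * (trunc_log 2 U).+2.
  rewrite big_ltn // [X in X + _]big1 ?add0n; last by [].
  apply: (@leq_trans (\sum_(1 <= u < U.+1) (\sum_(0 <= u' < u.+1) N %/ (u %/ gcdn u u') + u.+1))).
    rewrite !big_seq; apply: leq_sum => u; rewrite mem_index_iota => /andP[u_gt0 leuU].
    rewrite (big_cat_nat _ (n := u.+1)) //= [X in _ + X]big1_seq ?addn0; last first.
      by move=> u'; rewrite mem_index_iota /T => /andP[_ /andP[lt _]]; rewrite (leqNgt u') lt muln0.
    rewrite -[X in _ <= _ + X]mul1n -[X in _ <= _ + 1 * X]subn0 mulnC -sum_nat_const_nat -big_split /=.
    rewrite !big_seq; apply: leq_sum => u'; rewrite mem_index_iota => /andP[_ leu'].
    by rewrite /T u_gt0 (_ : u' <= u = true) ?leu' // !mul1n addn1.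
  rewrite big_split /= mulnSr [X in _ <= X]addnC addnC; apply: leq_add; last exact: sum_divn_gcdn.
  apply: (@leq_trans (\sum_(1 <= u < U.+1) U.+1)).
    by rewrite !big_seq; apply: leq_sum => u; rewrite mem_index_iota => /andP[_].
  rewrite sum_nat_const_nat subn1 /=; nia.
have -> : 4 * N * U * (trunc_log 2 U).+2 =
  2 * N * U * (trunc_log 2 U).+2 + 2 * N * U * (trunc_log 2 U).+2 by nia.
apply: leq_trans (leq_add T_sum T_sum).
rewrite [X in _ <= _ + X]exchange_big_nat /= -big_split /=; apply: leq_sum => u _.
rewrite -big_split big_mkcond /=; apply: leq_sum => u' _.
rewrite /T /F; case: ifP => // mx; have /orP[le|le] := leq_total u' u.
  by rewrite (maxn_idPl le) in mx *; rewrite mx le !mul1n leq_addr.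
by rewrite (maxn_idPr le) in mx *; rewrite mx le !mul1n gcdnC leq_addl.
Qed.

(** The pair [u = u' = 0] is left out because every pair of indices satisfies its equation. *)
Lemma sum_card_proportional p N U (a : 'F_p) (s : bool) : prime p -> U <= N ->
  \sum_(u < U.+1) \sum_(u' < U.+1 | 0 < maxn u u')
    #|[set ij : 'I_N * 'I_N |
      (a + ij.1%:R) * u'%:R == (-1) ^+ s * ((a + ij.2%:R) * u%:R)]%R|
    <= ((2 * N * U) %/ p).+1 * (4 * N * U * (trunc_log 2 U).+2).
Proof.
move=> p_pr leUN; apply: leq_trans (leq_mul (leqnn _) (sum_divn_maxn_gcdn leUN)).
rewrite big_distrr big_mkord /=; apply: leq_sum => u _.
rewrite big_distrr big_mkord /=; apply: leq_sum => u' mx.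
apply: leq_trans (card_proportional N a s p_pr mx) _.
rewrite leq_mul2r; apply/orP; right; rewrite ltnS; apply: leq_div2r.
have := ltn_ord u; have := ltn_ord u'; nia.
Qed.

(** * Multiplicative energy *)

Lemma card_set_pair (A B : finType) (P : A -> B -> bool) :
  #|[set z : A * B | P z.1 z.2]| = \sum_a #|[set b | P a b]|.
Proof.
rewrite -sum1dep_card -(pair_big_dep xpredT P (fun _ _ => 1)) /=.
by apply: eq_bigr => a _; rewrite sum1dep_card.
Qed.

(** For [X] without 0, this is the number of representations of [q] as a quotient of two elements of
    [X]. *)
Definition dilate_card (F : finFieldType) (X : {set F}) (q : F) : nat :=
  #|[set x in X | q * x \in X]%R|.

(** For [X] without 0, this is the number of solutions of [x * y' = x' * y] in [X]. *)
Definition mul_energy (F : finFieldType) (X : {set F}) : nat :=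
  \sum_(q : F | q != 0%R) dilate_card X q ^ 2.

Lemma mul_energyE (F : finFieldType) (X : {set F}) :
  mul_energy X = #|[set z : F * (F * F) | [&& z.1 != 0, z.2.1 \in X, z.2.2 \in X,
     z.1 * z.2.1 \in X & z.1 * z.2.2 \in X]]%R|.
Proof.
rewrite (card_set_pair (fun q (xy : F * F) => [&& q != 0, xy.1 \in X, xy.2 \in X,
     q * xy.1 \in X & q * xy.2 \in X])%R).
rewrite /mul_energy big_mkcond /=; apply: eq_bigr => q _; case: ifP => q0; last first.
  by apply/esym/eqP; rewrite cards_eq0; apply/eqP/setP => z; rewrite !inE.
rewrite /dilate_card -mulnn -cardsX; apply: eq_card => -[x y].
by rewrite !inE /=; do !case: (_ \in _).
Qed.

(** As [x] is nonzero, [q] is recovered from the triple [(q * x, x, y)] of elements of [X]. *)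
Lemma mul_energy_le_cube (F : finFieldType) (X : {set F}) :
  0%R \notin X -> mul_energy X <= #|X| ^ 3.
Proof.
move=> X0; rewrite mul_energyE.
have -> : #|X| ^ 3 = #|setX X (setX X X)|.
  by rewrite !cardsX !expnS expn0 muln1.
pose h (z : F * (F * F)) := (z.1 * z.2.1, (z.2.1, z.2.2))%R.
set S := [set _ | _].
have h_inj : {in S &, injective h}.
  move=> [q [x y]] [q' [x' y']]; rewrite !inE /= => /and5P[_ xX _ _ _] _ [E Ex Ey].
  rewrite -Ex -Ey in E *; congr pair; apply: mulIf E.
  by apply: contraNneq X0 => <-.
rewrite -(card_in_imset h_inj); apply/subset_leq_card/subsetP => _ /imsetP[z hz ->].
by move: hz; rewrite !inE => /and5P[_ -> -> -> _].
Qed.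

(** If [x], [y], [q * x], [q * y] lie in the interval, then [x * (q * y - q * x) = q * x * (y - x)],
    where both differences are integers of size at most [m] up to sign. This is an equation counted
    by [sum_card_proportional]. There are four choices of signs, and each allows [m ^ 2] cases where
    both differences vanish. *)
Lemma mul_energy_interval p m (a : 'F_p) : prime p ->
  mul_energy ([set a + i%:R | i : 'I_m]%R :\ 0%R)
    <= m ^ 2 * 2 ^ 2 + 4 * (((2 * m * m) %/ p).+1 * (4 * m * m * (trunc_log 2 m).+2)).
Proof.
move=> p_pr; set X : {set 'F_p} := (_ :\ _)%SET; rewrite mul_energyE.
pose cnt (s : bool) (u u' : nat) (ij : 'I_m * 'I_m) :=
  ((a + ij.1%:R) * u'%:R == (-1) ^+ s * ((a + ij.2%:R) * u%:R))%R.
pose D := [set z : ((bool * bool) * ('I_m.+1 * 'I_m.+1)) * ('I_m * 'I_m) |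
   cnt (z.1.1.1 (+) z.1.1.2) z.1.2.1 z.1.2.2 z.2].
apply: (@leq_trans #|D|); last first.
  rewrite (card_set_pair (fun w : (bool * bool) * ('I_m.+1 * 'I_m.+1) =>
     cnt (w.1.1 (+) w.1.2) w.2.1 w.2.2)).
  rewrite -(pair_bigA _ (fun ss (uu : 'I_m.+1 * 'I_m.+1) =>
    #|[set b | cnt (ss.1 (+) ss.2) uu.1 uu.2 b]|)) /=.
  have one (ss : bool * bool) :
     \sum_(j : 'I_m.+1 * 'I_m.+1) #|[set b | cnt (ss.1 (+) ss.2) j.1 j.2 b]|
     <= m ^ 2 + ((2 * m * m) %/ p).+1 * (4 * m * m * (trunc_log 2 m).+2).
    rewrite (bigID (fun j : 'I_m.+1 * 'I_m.+1 => 0 < maxn j.1 j.2)) /= addnC.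
    apply: leq_add.
      rewrite (big_pred1 (ord0, ord0)) => [|[u u']].
        by apply: leq_trans (max_card _) _; rewrite card_prod card_ord mulnn.
      by rewrite lt0n negbK -leqn0 geq_max !leqn0.
    apply: leq_trans (sum_card_proportional a (ss.1 (+) ss.2) p_pr (leqnn m)).
    by rewrite pair_big_dep.
  apply: (@leq_trans (\sum_(ss : bool * bool)
     (m ^ 2 + ((2 * m * m) %/ p).+1 * (4 * m * m * (trunc_log 2 m).+2)))).
    by apply: leq_sum => ss _; apply: one.
  by rewrite sum_nat_const card_prod card_bool; lia.
have X_idx (x : 'F_p) : x \in X -> exists i : 'I_m, x = (a + i%:R)%R.
  by rewrite !inE => /andP[_ /imsetP[i _ ->]]; exists i.
have X_neq0 (x : 'F_p) : x \in X -> x != 0%R by rewrite !inE => /andP[].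
clearbody X.
have [->|/set0Pn[x0 x0X]] := eqVneq X set0.
  have -> : #|[set z : 'F_p * ('F_p * 'F_p) | [&& z.1 != 0, z.2.1 \in set0, z.2.2 \in set0,
     z.1 * z.2.1 \in set0 & z.1 * z.2.2 \in set0]]%R| = 0 => //.
  by apply/eqP; rewrite cards_eq0; apply/eqP/setP => z; rewrite !inE /= andbF.
have [i0 _] := X_idx _ x0X.
(* The default [i0] is never returned on [X]. *)
pose idx (x : 'F_p) : 'I_m := odflt i0 [pick i : 'I_m | x == a + i%:R]%R.
have idxK (x : 'F_p) : x \in X -> (a + (idx x)%:R = x)%R.
  move=> /X_idx[i Ei]; rewrite /idx; case: pickP => [j /eqP -> //|/(_ i)].
  by rewrite Ei eqxx.
pose sg (i j : 'I_m) := j < i.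
(* One of the truncated differences is zero, so this is the distance of [i] and [j]; [sg] keeps the
   sign. *)
pose ds (i j : 'I_m) : 'I_m.+1 := inord ((i - j) + (j - i)).
have dsE i j : ((ds i j)%:R = (-1) ^+ sg i j * (j%:R - i%:R) :> 'F_p)%R.
  rewrite /ds inordK; last by have := ltn_ord i; have := ltn_ord j; lia.
  rewrite /sg; case: ltnP => h.
    have -> : (i - j + (j - i) = i - j)%N by lia.
    by rewrite natrB ?(ltnW h) // mulN1r opprB.
  have -> : (i - j + (j - i) = j - i)%N by lia.
  by rewrite natrB // mul1r.
pose h (z : 'F_p * ('F_p * 'F_p)) :=
  let i := idx z.2.1 in let j := idx z.2.2 in
  let i' := idx (z.1 * z.2.1)%R in let j' := idx (z.1 * z.2.2)%R in
  (((sg i j, sg i' j'), (ds i j, ds i' j')), (i, i')).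
set S := [set _ | _].
(* The recorded indices give [x] and [q * x], the signed difference then gives [y], and division by
   [x] gives [q]. *)
have h_inj : {in S &, injective h}.
  move=> [q [x y]] [q' [x' y']]; rewrite !inE /=.
  move=> /and5P[q0 xX yX qxX qyX] /and5P[q0' xX' yX' qxX' qyX'].
  rewrite /h /= => E.
  have Es := congr1 (fun w => w.1.1.1) E; have Ed := congr1 (fun w => w.1.2.1) E.
  have Ei := congr1 (fun w => w.2.1) E; have Ei' := congr1 (fun w => w.2.2) E.
  rewrite /= in Es Ed Ei Ei'.
  have Ex : x = x' by rewrite -(idxK _ xX) -(idxK _ xX') Ei.
  have Eq : (q * x = q' * x')%R by rewrite -(idxK _ qxX) -(idxK _ qxX') Ei'.
  have Ey : y = y'.
    move: Ed => /(congr1 (fun u : 'I_m.+1 => (u%:R : 'F_p)%R)).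
    rewrite !dsE Ei -Es -Ei => /(can_inj (signrMK _)) /addIr Ej.
    by rewrite -(idxK _ yX) -(idxK _ yX') Ej.
  congr pair; last by congr pair.
  by move: Eq; rewrite -Ex; apply: mulIf; apply: X_neq0.
rewrite -(card_in_imset h_inj); apply/subset_leq_card/subsetP => _ /imsetP[[q [x y]] hz ->].
move: hz; rewrite !inE /= => /and5P[q0 xX yX qxX qyX].
rewrite /h /cnt /= !dsE !idxK //.
have E1 : ((idx y)%:R - (idx x)%:R = y - x :> 'F_p)%R.
  by rewrite -{2}(idxK _ yX) -{2}(idxK _ xX); ring.
have E2 : ((idx (q * y))%:R - (idx (q * x))%:R = q * y - q * x :> 'F_p)%R.
  by rewrite -{2}(idxK _ qyX) -{2}(idxK _ qxX); ring.
rewrite E1 E2 signr_addb; set s1 := (_ ^+ sg _ _)%R; set s2 := (_ ^+ sg _ _)%R.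
have s2K : (s2 * s2 = 1)%R by rewrite -signr_addb addbb.
apply/eqP; transitivity (s2 * s2 * (x * (s1 * (q * y - q * x))))%R; first by rewrite s2K mul1r.
by ring.
Qed.

(** * Sums of reciprocals *)

Lemma sqrn_sum_le (T : finType) (B : {set T}) (f : T -> nat) :
  (\sum_(x in B) f x) ^ 2 <= #|B| * \sum_(x in B) f x ^ 2.
Proof.
rewrite -(@leq_pmul2l 2) //.
have -> : 2 * (\sum_(x in B) f x) ^ 2 = \sum_(x in B) \sum_(y in B) 2 * (f x * f y).
  rewrite -mulnn big_distrlr big_distrr /=; apply: eq_bigr => x _.
  by rewrite big_distrr.
have -> : 2 * (#|B| * \sum_(x in B) f x ^ 2) = \sum_(x in B) \sum_(y in B) (f x ^ 2 + f y ^ 2).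
  under [RHS]eq_bigr do rewrite big_split /= sum_nat_const.
  by rewrite big_split /= sum_nat_const -big_distrr /= mul2n addnn.
by apply: leq_sum => x _; apply: leq_sum => y _; apply: nat_Cauchy.
Qed.

Lemma card_fibers_sqr (T U : finType) (f : T -> U) (S : {set T}) :
  \sum_(y in f @: S) #|[set x in S | f x == y]| ^ 2
    = #|[set z : T * T | [&& z.1 \in S, z.2 \in S & f z.1 == f z.2]]|.
Proof.
rewrite (card_set_pair (fun x y => [&& x \in S, y \in S & f x == f y])).
rewrite (bigID (mem S)) /= [X in _ + X]big1 ?addn0; last first.
  move=> x /negPf xS; apply/eqP; rewrite cards_eq0; apply/eqP/setP => y.
  by rewrite !inE xS.
rewrite (partition_big_imset f) /=; apply: eq_bigr => y _.
under eq_bigr => x /andP[xS /eqP fx].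
  have -> : [set b | [&& x \in S, b \in S & f x == f b]] = [set x in S | f x == y].
    by apply/setP => b; rewrite !inE xS fx eq_sym.
  over.
rewrite sum_nat_const -mulnn; congr muln; apply: eq_card => x.
by rewrite !inE.
Qed.

(** Cauchy-Schwarz over the fibres of [f]: their sizes add up to [#|S|] and the squares of the sizes
    count the colliding pairs. *)
Lemma card_imset_collisions (T U : finType) (f : T -> U) (S : {set T}) :
  #|S| ^ 2 <= #|f @: S| *
    #|[set z : T * T | [&& z.1 \in S, z.2 \in S & f z.1 == f z.2]]|.
Proof.
rewrite -card_fibers_sqr; apply: leq_trans (sqrn_sum_le _ _).
rewrite leq_sqr -sum1_card (partition_big_imset f) /=.
apply: leq_sum => y _; rewrite -sum1dep_card; apply: eq_leq.
by apply: eq_bigl => x; rewrite ?inE.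
Qed.

(** Common terms cancel, which leaves a signed sum over the symmetric difference [D]. Clearing
    denominators turns it into a nonzero polynomial of degree below [#|D|] that vanishes at every
    such [b]. *)
Lemma card_reciprocal_collision (F : finFieldType) (T : finType) (c : T -> F)
    (W W' : {set T}) : injective c -> W != W' ->
  #|[set b : F | [forall v, b + c v != 0] &&
     (\sum_(v in W) (b + c v)^-1 == \sum_(v in W') (b + c v)^-1)]%R| <= #|W| + #|W'|.
Proof.
move=> c_inj neWW'.
pose D := (W :\: W') :|: (W' :\: W).
pose eps v : F := (if v \in W then 1 else -1)%R.
have epsD b : (\sum_(v in W) (b + c v)^-1 - \sum_(v in W') (b + c v)^-1
    = \sum_(v in D) eps v * (b + c v)^-1)%R.
  rewrite (big_setID W') [X in (_ - X)%R](big_setID W) /= setIC opprD addrACA subrr add0r.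
  have DW : D :&: W = W :\: W'.
    by apply/setP => v; rewrite !inE; case: (v \in W); case: (v \in W').
  have DW' : D :\: W = W' :\: W.
    by apply/setP => v; rewrite !inE; case: (v \in W); case: (v \in W').
  rewrite [RHS](big_setID W) /= DW DW'.
  rewrite -sumrN; congr (_ + _)%R; apply: eq_bigr => v; rewrite !inE /eps.
    by move=> /andP[_ ->]; rewrite mul1r.
  by move=> /andP[/negPf -> _]; rewrite mulN1r.
pose P : {poly F} := (\sum_(v in D) eps v *: \prod_(w in D :\ v) ('X + (c w)%:P))%R.
have PE b : (forall v, b + c v != 0)%R ->
    (P.[b] = (\prod_(w in D) (b + c w)) * \sum_(v in D) eps v * (b + c v)^-1)%R.
  move=> nz; rewrite /P horner_sum big_distrr /=; apply: eq_bigr => v vD.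
  rewrite hornerZ horner_prod [in RHS](big_setD1 v) //=.
  under eq_bigr do rewrite hornerD hornerX hornerC.
  by set Q := (\prod_(_ in _) _)%R; field.
have [v0 v0D] : exists v, v \in D.
  apply/set0Pn; apply: contra neWW' => /eqP D0; apply/eqP/setP => v.
  by have /setP/(_ v) := D0; rewrite !inE; case: (v \in W); case: (v \in W').
(* At [- c v0] only the summand of [v0] survives, and its factors are nonzero because [c] is
   injective. *)
have P_neq0 : P != 0%R.
  apply/eqP => P0; have : (P.[- c v0] = 0)%R by rewrite P0 horner0.
  rewrite /P horner_sum; under eq_bigr do rewrite hornerZ horner_prod.
  rewrite (big_setD1 v0) //= [X in (_ + X)%R]big1 ?addr0 => [|v]; last first.
    rewrite in_setD1 => /andP[nev vD]; rewrite (big_setD1 v0) /=; last first.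
      by rewrite in_setD1 eq_sym nev.
    by rewrite hornerD hornerX hornerC addNr mul0r mulr0.
  move/eqP; rewrite mulf_eq0 => /orP[].
    by rewrite /eps; case: ifP; rewrite ?oppr_eq0 oner_eq0.
  rewrite prodf_seq_eq0 => /hasP[v _ /andP[]]; rewrite !inE => /andP[nev _].
  by rewrite hornerD hornerX hornerC addrC subr_eq0 (inj_eq c_inj) (negPf nev).
have size_P : size P <= #|D|.
  apply: leq_trans (size_sum _ _ _) _; apply/bigmax_leqP => v vD.
  apply: leq_trans (size_scale_leq _ _) _.
  under eq_bigr do rewrite -[c _]opprK polyCN.
  by rewrite -big_enum /= (size_prod_XsubC _ (fun w => - c w)%R) -cardE (cardsD1 v D) vD.
set R := [set b | _].
have R_roots : all (root P) (enum R).
  apply/allP => b; rewrite mem_enum inE => /andP[/forallP nz].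
  by rewrite -subr_eq0 epsD => /eqP E; rewrite rootE PE // E mulr0.
have := max_poly_roots P_neq0 R_roots (enum_uniq _).
rewrite -cardE => lt; apply: leq_trans (ltnW (leq_trans lt size_P)) _.
apply: leq_trans (leq_card_setU _ _) _.
by apply: leq_add; apply: subset_leq_card; apply: subsetDl.
Qed.

(** Over all [b] in [B], the coincidences number at most [C * #|B|] from equal subsets and [2 * k]
    for each other pair of subsets. Some [b] does no worse than the average, and few collisions
    force many values. *)
Lemma exists_many_reciprocal_sums (F : finFieldType) (T : finType) (c : T -> F)
    (k : nat) (B : {set F}) : injective c -> (0 < #|B|) -> 0 < 'C(#|T|, k) ->
  (forall b v, b \in B -> (b + c v)%R != 0%R) ->
  exists2 b, b \in B &
    'C(#|T|, k) * #|B| <=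
      #|[set (\sum_(v in pred_of_set W) (b + c v)^-1)%R | W : {set T} in [set W : {set T} | #|W| == k]]|
        * (#|B| + 2 * k * 'C(#|T|, k)).
Proof.
move=> c_inj B_gt0 C_gt0 nzB; set WW := [set W : {set T} | _]; set C := 'C(_, _).
have cardWW : #|WW| = C by rewrite /C -card_draws; apply: eq_card => W; rewrite !inE.
pose f b (W : {set T}) := (\sum_(v in W) (b + c v)^-1)%R.
pose coll b := #|[set z : {set T} * {set T} | [&& z.1 \in WW, z.2 \in WW & f b z.1 == f b z.2]]|.
have sum_coll : \sum_(b in B) coll b <= C * #|B| + 2 * k * C ^ 2.
  have -> : \sum_(b in B) coll b = \sum_(W in WW) \sum_(W' in WW) #|[set b in B | f b W == f b W']|.
    rewrite pair_big_dep /=.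
    under eq_bigr do rewrite /coll -sum1dep_card big_mkcond /=.
    rewrite exchange_big /= [RHS]big_mkcond /=; apply: eq_bigr => -[W W'] _ /=.
    rewrite -sum1dep_card; case: ifP => [/andP[-> ->]|/negbT hW].
      by rewrite big_mkcond [RHS]big_mkcond /=; apply: eq_bigr => b _; case: (b \in B).
    by rewrite big1 // => b _; case: ifP => // /and3P[h1 h2 _]; rewrite h1 h2 in hW.
  apply: (@leq_trans (\sum_(W in WW) \sum_(W' in WW) ((W == W') * #|B| + 2 * k))).
    apply: leq_sum => W hW; apply: leq_sum => W' hW'.
    have [<-|neW] := eqVneq W W'.
      rewrite mul1n; apply: leq_trans (leq_addr _ _); apply: subset_leq_card.
      by apply/subsetP => b; rewrite inE => /andP[].
    rewrite mul0n add0n mul2n -addnn.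
    move: hW hW'; rewrite !inE => /eqP hW /eqP hW'; rewrite -{1}hW -hW'.
    apply: leq_trans (card_reciprocal_collision c_inj neW); apply: subset_leq_card.
    apply/subsetP => b; rewrite !inE => /andP[bB ->]; rewrite andbT.
    by apply/forallP => v; apply: nzB.
  under eq_bigr do rewrite big_split /= sum_nat_const.
  rewrite big_split /= sum_nat_const cardWW -mulnn; apply: leq_add; last by lia.
  rewrite -cardWW -sum_nat_const; apply: leq_sum => W hW.
  rewrite (bigD1 W) //= eqxx mul1n big1 ?addn0 // => W' /andP[_ /negPf].
  by rewrite eq_sym => ->.
have [b bB le_coll] : exists2 b, b \in B & #|B| * coll b <= C * #|B| + 2 * k * C ^ 2.
  case: (pickP [pred b in B | #|B| * coll b <= C * #|B| + 2 * k * C ^ 2]) => [b /andP[bB h]|no].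
    by exists b.
  suff : (C * #|B| + 2 * k * C ^ 2) * #|B| < #|B| * \sum_(b in B) coll b.
    by rewrite [X in X < _]mulnC ltn_pmul2l // ltnNge sum_coll.
  rewrite big_distrr /= mulnC -sum_nat_const.
  have [b0 b0B] : exists b0, b0 \in B by apply/card_gt0P.
  have lt b : b \in B -> C * #|B| + 2 * k * C ^ 2 < #|B| * coll b.
    by move=> bB; have := no b; rewrite /= bB /= => /negbT; rewrite -ltnNge.
  rewrite (bigD1 b0) //= [X in _ < X](bigD1 b0) //= -addSn; apply: leq_add.
    exact: lt.
  by apply: leq_sum => b /andP[bB _]; apply: ltnW; apply: lt.
exists b => //; rewrite -(leq_pmul2l C_gt0).
have := card_imset_collisions (f b) WW; rewrite cardWW -/(coll b).
set A := #|_ @: _|; set cb := coll b => hA.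
have -> : C * (C * #|B|) = #|B| * C ^ 2 by rewrite -mulnn; lia.
apply: leq_trans (leq_mul (leqnn #|B|) hA) _.
rewrite mulnCA; apply: leq_trans (leq_mul (leqnn A) le_coll) _.
by apply: eq_leq; rewrite -mulnn; lia.
Qed.

Lemma natr_Fp_neq0 p n : prime p -> 0 < n < p -> (n%:R != 0 :> 'F_p)%R.
Proof.
move=> p_pr /andP[n_gt0 ltnp]; apply/eqP => /(@natr_Fp_inj p n 0 p_pr).
by rewrite mod0n modn_small // => n0; rewrite n0 in n_gt0.
Qed.

(** The successor makes the denominators run over 1, ..., [U]; for [U < p] this counts the
    representations of [b] as [(a + i) / u]. *)
Definition ratio_card p n U (a b : 'F_p) : nat :=
  #|[set z : 'I_n * 'I_U | a + z.1%:R == b * z.2.+1%:R]%R|.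

(** The squares count the pairs of equal fractions [(a + i) / u = (a + i') / u']; cross-multiplied,
    these are proportional pairs with the plus sign. *)
Lemma sum_ratio_card_sqr p n U (a : 'F_p) : prime p -> U <= n -> U < p ->
  \sum_b ratio_card n U a b ^ 2
    <= ((2 * n * U) %/ p).+1 * (4 * n * U * (trunc_log 2 U).+2).
Proof.
move=> p_pr leUn ltUp.
pose f (z : 'I_n * 'I_U) := ((a + z.1%:R) / z.2.+1%:R)%R.
have u_neq0 (u : 'I_U) : (u.+1%:R != 0 :> 'F_p)%R.
  by apply: natr_Fp_neq0 => //=; apply: leq_ltn_trans ltUp.
have rhoE b : ratio_card n U a b = #|[set z in setT | f z == b]|.
  apply: eq_card => z; rewrite !inE /= /f.
  by rewrite -[RHS](inj_eq (mulIf (u_neq0 z.2))) divfK.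
under eq_bigr do rewrite rhoE.
rewrite (bigID (mem (f @: setT))) /= [X in _ + X]big1 ?addn0 => [|b nb]; last first.
  apply/eqP; rewrite expn_eq0 andbT cards_eq0; apply/eqP/setP => z; rewrite !inE /=.
  by apply: contraNF nb => /eqP <-; apply: imset_f; rewrite inE.
rewrite card_fibers_sqr.
apply: leq_trans (sum_card_proportional a false p_pr leUn).
rewrite pair_big_dep big_mkcond /=.
pose P (uu : 'I_U.+1 * 'I_U.+1) (ij : 'I_n * 'I_n) := (0 < maxn uu.1 uu.2) &&
  ((a + ij.1%:R) * uu.2%:R == (-1) ^+ false * ((a + ij.2%:R) * uu.1%:R))%R.
apply: (@leq_trans #|[set z | P z.1 z.2]|); last first.
  rewrite card_set_pair; apply: leq_sum => uu _; rewrite /P; case: ifP => //= _.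
  by rewrite leqn0 cards_eq0; apply/eqP/setP => z; rewrite !inE.
pose h (zz : ('I_n * 'I_U) * ('I_n * 'I_U)) : ('I_U.+1 * 'I_U.+1) * ('I_n * 'I_n) :=
  ((inord zz.1.2.+1, inord zz.2.2.+1), (zz.1.1, zz.2.1)).
have inordU (u : 'I_U) : (@inord U u.+1 : nat) = u.+1.
  by rewrite inordK // ltnS.
have h_inj : injective h.
  move=> [[i u] [i' u']] [[j v] [j' v']] E.
  have E1 := congr1 (fun w => nat_of_ord w.1.1) E; have E2 := congr1 (fun w => nat_of_ord w.1.2) E.
  have E3 := congr1 (fun w => w.2.1) E; have E4 := congr1 (fun w => w.2.2) E.
  rewrite /= !inordU in E1 E2 E3 E4; case: E1 => E1; case: E2 => E2.
  by rewrite E3 E4 (val_inj E1) (val_inj E2).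
rewrite -(card_imset _ h_inj); apply/subset_leq_card/subsetP => _ /imsetP[[[i u] [i' u']] hz ->].
move: hz; rewrite !inE /= /P /= /f /= => /eqP E.
rewrite !inordU /= expr0 mul1r (leq_trans _ (leq_maxl _ _)) //=.
by rewrite -[X in (X * _)%R](divfK (u_neq0 u)) E mulrAC divfK.
Qed.

Lemma sum_ratio_card p n U (a : 'F_p) : prime p -> U < p ->
  \sum_b ratio_card n U a b = n * U.
Proof.
move=> p_pr ltUp; transitivity #|{: 'I_n * 'I_U}|; last by rewrite card_prod !card_ord.
rewrite -sum1_card (partition_big (fun z : 'I_n * 'I_U => (a + z.1%:R) / z.2.+1%:R)%R xpredT) //=.
apply: eq_bigr => b _; rewrite /ratio_card -sum1dep_card; apply: eq_bigl => z; rewrite ?inE /=.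
have u_neq0 : (z.2.+1%:R != 0 :> 'F_p)%R.
  by apply: natr_Fp_neq0 => //=; apply: leq_ltn_trans ltUp.
by rewrite -[RHS](inj_eq (mulIf u_neq0)) divfK.
Qed.

(** Ratios represented less than half as often as the average account for at most half of the
    [n * U] representations. Cauchy-Schwarz on the others, with the second moment, gives the bound;
    16 is the square of the lost factor 2 times the 4 of the second moment. *)
Lemma card_popular_ratios p n U (a : 'F_p) : prime p -> 0 < U <= n -> U < p ->
  n * U <= 16 * ((2 * n * U) %/ p).+1 * (trunc_log 2 U).+2
             * #|[set b | n * U <= 2 * p * ratio_card n U a b]|.
Proof.
move=> p_pr /andP[U_gt0 leUn] ltUp; set B := [set b | _].
set K := (_ %/ p).+1; set L := (trunc_log 2 U).+2.
have sumB : n * U <= 2 * \sum_(b in B) ratio_card n U a b.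
  have p_gt0 := prime_gt0 p_pr.
  have : \sum_(b | b \notin B) 2 * p * ratio_card n U a b <= p * (n * U).
    apply: (@leq_trans (\sum_(b : 'F_p) (n * U))); last by rewrite sum_nat_const card_Fp.
    rewrite big_mkcond /=; apply: leq_sum => b _; rewrite inE -ltnNge.
    by case: ifP => // /ltnW.
  rewrite -big_distrr /= -mulnA mulnCA leq_pmul2l // => le_out.
  have := sum_ratio_card n a p_pr ltUp; rewrite (bigID (mem B)) /=.
  by move: le_out; set x := \sum_(_ | _) _; set y := \sum_(_ | _) _; lia.
have := sqrn_sum_le B (ratio_card n U a); set S := \sum_(_ in _) _ in sumB *.
have le2 : \sum_(b in B) ratio_card n U a b ^ 2 <= K * (4 * n * U * L).
  apply: leq_trans (sum_ratio_card_sqr a p_pr leUn ltUp).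
  by rewrite [X in _ <= X](bigID (mem B)) /= leq_addr.
move=> /leq_trans -/(_ _ (leq_mul (leqnn _) le2)) le3.
have nU_gt0 : 0 < n * U by rewrite muln_gt0 U_gt0 (leq_trans U_gt0 leUn).
rewrite -(leq_pmul2l nU_gt0).
have : (n * U) ^ 2 <= 4 * S ^ 2 by rewrite -(expnMn 2 S 2) leq_sqr.
rewrite -mulnn; move: le3; clear.
by move: #|B| => cB; set x := S ^ 2; nia.
Qed.

(** * Fourth moment and covering by products *)

Local Open Scope ring_scope.

(** Lagrange's identity. Nonnegativity makes the entries real, so that the squares in the identity
    are nonnegative even if the order of [R] is partial. *)
Lemma Cauchy_Schwarz_nneg (R : numDomainType) (T : finType) (P : pred T) (x y : T -> R) :
  (forall i, 0 <= x i) -> (forall i, 0 <= y i) ->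
  (\sum_(i | P i) x i * y i) ^+ 2 <= (\sum_(i | P i) x i ^+ 2) * (\sum_(i | P i) y i ^+ 2).
Proof.
move=> x_ge0 y_ge0; rewrite -subr_ge0 -(pmulr_rge0 _ (ltr0n R 2)).
have -> : 2 * ((\sum_(i | P i) x i ^+ 2) * (\sum_(i | P i) y i ^+ 2)
               - (\sum_(i | P i) x i * y i) ^+ 2)
    = \sum_(i | P i) \sum_(j | P j) (x i * y j - x j * y i) ^+ 2.
  have -> : \sum_(i | P i) \sum_(j | P j) (x i * y j - x j * y i) ^+ 2 =
     \sum_(i | P i) \sum_(j | P j) (x i ^+ 2 * y j ^+ 2) +
     \sum_(i | P i) \sum_(j | P j) (x j ^+ 2 * y i ^+ 2) -
     \sum_(i | P i) \sum_(j | P j) 2 * ((x i * y i) * (x j * y j)).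
    rewrite -big_split -sumrB /=; apply: eq_bigr => i _.
    rewrite -big_split -sumrB /=; apply: eq_bigr => j _; ring.
  rewrite [X in _ + X - _]exchange_big /= -!big_distrlr /=.
  under [X in _ - X]eq_bigr do rewrite -big_distrr /=.
  rewrite -[X in _ - X]big_distrr -big_distrlr /=.
  by ring.
apply: sumr_ge0 => i _; apply: sumr_ge0 => j _; rewrite real_exprn_even_ge0 //.
by rewrite rpredB ?ger0_real ?mulr_ge0.
Qed.

Lemma sum_dilate_l (F : finFieldType) (M : nmodType) (f : F -> M) (t : F) : t != 0 ->
  \sum_(t' | t' != 0) f (t' / t) = \sum_(q | q != 0) f q.
Proof.
move=> t0; rewrite (reindex_onto (fun q => q * t) (fun t' => t' / t)) /=; last first.
  by move=> t' _; rewrite divfK.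
apply: eq_big => q; first by rewrite mulfK // eqxx andbT mulf_eq0 (negPf t0) orbF.
by move=> _; rewrite mulfK.
Qed.

Lemma sum_dilate_r (F : finFieldType) (M : nmodType) (f : F -> M) (t : F) : t != 0 ->
  \sum_(t' | t' != 0) f (t / t') = \sum_(q | q != 0) f q.
Proof.
move=> t0; rewrite (reindex_onto (fun q => t / q) (fun t' => t / t')) /=; last first.
  by move=> t' t'0; rewrite invf_div mulrCA divff // mulr1.
apply: eq_big => q.
  have [->|q0] := eqVneq q 0; first by rewrite invr0 mulr0 eqxx.
  by rewrite mulf_eq0 invr_eq0 (negPf t0) (negPf q0) /= invf_div mulrCA divff // mulr1 eqxx.
by move=> /andP[nz /eqP E]; rewrite -{2}E.
Qed.

(** Let [X] be the fourth moment and [E] the sum of the [kappa q ^ 2]. Duality writes [X] as a sum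
    of a function [g] over [A]; Cauchy-Schwarz over [A] gives [X ^ 2 <= #|A| * Y], and a second one
    over the pairs [(t, t')] gives [Y ^ 2 <= E * X ^ 3]. *)
Lemma fourth_moment (F : finFieldType) (C : numClosedFieldType) (f : F -> C)
    (A : {set F}) (kappa : F -> nat) :
  (forall t t', t != 0 -> t' != 0 ->
     `|\sum_z f (t * z) * (f (t' * z))^*| <= (kappa (t' / t))%:R) ->
  \sum_(t | t != 0) `|\sum_(a in A) f (t * a)| ^+ 4
    <= (#|A| ^ 2 * \sum_(q | q != 0%R) kappa q ^ 2)%N%:R.
Proof.
move=> kernel; set E := (\sum_(q | _) _)%N.
pose S t := \sum_(a in A) f (t * a); pose n t : C := `|S t|.
have n_ge0 t : 0 <= n t by apply: normr_ge0.
set X := \sum_(t | _) _.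
have XE : X = \sum_(t | t != 0) n t ^+ 4 by [].
have X_ge0 : 0 <= X by apply: sumr_ge0 => t _; apply: exprn_ge0.
(* This weight satisfies [theta t * S t = n t ^+ 4]. *)
pose theta t := n t ^+ 2 * (S t)^*.
have n_theta t : `|theta t| = n t ^+ 3.
  by rewrite /theta normrM normrX norm_conjC normr_id -exprSr.
pose g z := \sum_(t | t != 0) theta t * f (t * z).
have Xg : X = \sum_(a in A) g a.
  rewrite exchange_big /= XE; apply: eq_bigr => t _; rewrite -big_distrr /= -/(S t).
  by rewrite /theta -mulrA [_^* * _]mulrC -normCK -/(n t) -exprD.
pose k t t' : C := (kappa (t' / t))%:R.
pose Y := \sum_(t | t != 0) \sum_(t' | t' != 0) n t ^+ 3 * n t' ^+ 3 * k t t'.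
(* Summing over the whole field instead of [A] brings in the correlations of the dilates of [f]. *)
have gY : \sum_z `|g z| ^+ 2 <= Y.
  have gE : \sum_z `|g z| ^+ 2 = \sum_(t | t != 0) \sum_(t' | t' != 0)
      theta t * (theta t')^* * \sum_z f (t * z) * (f (t' * z))^*.
    under eq_bigr => z _.
      rewrite normCK {2}/g rmorph_sum /= /g big_distrlr /=.
      over.
    rewrite exchange_big; apply: eq_bigr => t _ /=.
    rewrite exchange_big; apply: eq_bigr => t' _ /=.
    rewrite big_distrr; apply: eq_bigr => z _ /=.
    by rewrite rmorphM mulrACA.
  rewrite -[X in X <= _]ger0_norm; last by apply: sumr_ge0 => z _; apply: exprn_ge0.
  rewrite gE.
  apply: le_trans (ler_norm_sum _ _ _) _; apply: ler_sum => t t0.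
  apply: le_trans (ler_norm_sum _ _ _) _; apply: ler_sum => t' t'0.
  rewrite normrM normrM norm_conjC !n_theta; apply: ler_wpM2l; last exact: kernel.
  by rewrite mulr_ge0 ?exprn_ge0.
have X2 : X ^+ 2 <= #|A|%:R * Y.
  apply: (@le_trans _ _ (#|A|%:R * \sum_(a in A) `|g a| ^+ 2)).
    have -> : #|A|%:R = \sum_(a in A) (1 : C) ^+ 2 by rewrite expr1n -sum1_card natr_sum.
    apply: le_trans (Cauchy_Schwarz_nneg _ (fun _ => ler01) (fun a => normr_ge0 (g a))).
    under eq_bigr do rewrite mul1r.
    rewrite ler_sqr ?nnegrE //; last by apply: sumr_ge0.
    by rewrite -[X in X <= _]ger0_norm // Xg ler_norm_sum.
  apply: ler_wpM2l; first exact: ler0n.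
  apply: le_trans gY.
  rewrite [X in _ <= X](bigID (mem A)) /= lerDl.
  by apply: sumr_ge0 => z _; apply: exprn_ge0.
have Y_ge0 : 0 <= Y.
  apply: sumr_ge0 => t _; apply: sumr_ge0 => t' _.
  by rewrite !mulr_ge0 ?exprn_ge0 ?ler0n.
have sumk t : t != 0 -> \sum_(t' | t' != 0) k t t' ^+ 2 = E%:R.
  move=> t0; rewrite (sum_dilate_l (fun q => (kappa q)%:R ^+ 2) t0) /E natr_sum.
  by apply: eq_bigr => q _; rewrite natrX.
have sumk' t' : t' != 0 -> \sum_(t | t != 0) k t t' ^+ 2 = E%:R.
  move=> t0; rewrite (sum_dilate_r (fun q => (kappa q)%:R ^+ 2) t0) /E natr_sum.
  by apply: eq_bigr => q _; rewrite natrX.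
(* Each term is split as [k n n'] times [n ^ 2 n' ^ 2]. In the square of the first factor, twice
   [n ^ 2 n' ^ 2] is at most [n ^ 4 + n' ^ 4], after which one variable enters only through [k] and
   its sum is [E]. *)
have Y2 : Y ^+ 2 <= E%:R * X ^+ 3.
  have -> : Y = \sum_(w : F * F | (w.1 != 0) && (w.2 != 0))
      (k w.1 w.2 * (n w.1 * n w.2)) * (n w.1 ^+ 2 * n w.2 ^+ 2).
    rewrite /Y pair_big_dep /=; apply: eq_bigr => -[t t'] _ /=; ring.
  apply: le_trans (Cauchy_Schwarz_nneg _ _ _) _ => [w|w|].
  - by rewrite !mulr_ge0 ?ler0n.
  - by rewrite !mulr_ge0 ?exprn_ge0.
  have -> : \sum_(w : F * F | (w.1 != 0) && (w.2 != 0)) (n w.1 ^+ 2 * n w.2 ^+ 2) ^+ 2 = X ^+ 2.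
    rewrite expr2 {1}XE XE big_distrlr pair_big_dep /=.
    by apply: eq_bigr => -[t t'] _ /=; ring.
  rewrite [X ^+ 3]exprS mulrA; apply: ler_wpM2r; first exact: exprn_ge0.
  rewrite -(ler_pM2l (ltr0n C 2)).
  have -> : 2 * (E%:R * X) = \sum_(w : F * F | (w.1 != 0) && (w.2 != 0))
      (k w.1 w.2 ^+ 2 * (n w.1 ^+ 4 + n w.2 ^+ 4)).
    under [RHS]eq_bigr do rewrite mulrDr.
    rewrite big_split /= mulr_natl mulr2n; congr (_ + _).
      rewrite -(pair_big_dep (fun t : F => t != 0) (fun _ t' : F => t' != 0) (fun t t' => k t t' ^+ 2 * n t ^+ 4)) /= XE big_distrr /=.
      by apply: eq_bigr => t t0; rewrite -big_distrl /= sumk.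
    rewrite -(pair_big_dep (fun t : F => t != 0) (fun _ t' : F => t' != 0) (fun t t' => k t t' ^+ 2 * n t' ^+ 4)) /= XE big_distrr /=.
    rewrite exchange_big /=.
    by apply: eq_bigr => t t0; rewrite -big_distrl /= sumk'.
  rewrite big_distrr /=; apply: ler_sum => w _.
  have -> : 2 * (k w.1 w.2 * (n w.1 * n w.2)) ^+ 2 =
     k w.1 w.2 ^+ 2 * (2 * (n w.1 ^+ 2 * n w.2 ^+ 2)) by ring.
  apply: ler_wpM2l; rewrite ?exprn_ge0 ?ler0n // -subr_ge0.
  have -> : n w.1 ^+ 4 + n w.2 ^+ 4 - 2 * (n w.1 ^+ 2 * n w.2 ^+ 2) = (n w.1 ^+ 2 - n w.2 ^+ 2) ^+ 2 by ring.
  by rewrite real_exprn_even_ge0 // rpredB ?ger0_real ?exprn_ge0.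
have [X0|X_neq0] := eqVneq X 0; first by rewrite X0 ler0n.
have X_gt0 : 0 < X by rewrite lt0r X_neq0.
rewrite -(ler_pM2r (exprn_gt0 3 X_gt0)) -exprS natrM natrX -mulrA.
apply: le_trans (ler_wpM2l (exprn_ge0 2 (ler0n _ _)) Y2).
rewrite -exprMn (exprM X 2 2) ler_sqr ?nnegrE ?exprn_ge0 //.
by rewrite mulr_ge0 ?ler0n.
Qed.

(** The last clause is orthogonality; at [x = 1] it forces [e] to be nontrivial. *)
Definition add_character (F : finFieldType) (C : numClosedFieldType) (e : F -> C) :=
  [/\ {morph e : x y / x + y >-> x * y}, forall x, `|e x| = 1 &
      forall x, \sum_z e (z * x) = (#|F| * (x == 0))%:R].

Lemma add_character0 (F : finFieldType) (C : numClosedFieldType) (e : F -> C) :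
  add_character e -> e 0 = 1.
Proof.
case=> eD e1 _; have e0 : e 0 != 0 by rewrite -normr_eq0 e1 oner_eq0.
by apply: (mulfI e0); rewrite -eD addr0 mulr1.
Qed.

Lemma add_characterN (F : finFieldType) (C : numClosedFieldType) (e : F -> C) x :
  add_character e -> e (- x) = (e x)^*.
Proof.
move=> he; have [eD e1 _] := he; have ex : e x != 0 by rewrite -normr_eq0 e1 oner_eq0.
apply: (mulfI ex); rewrite -eD subrr add_character0 //.
by rewrite -normCK e1 expr1n.
Qed.

(** Without a solution, orthogonality makes the Fourier sum over all [t] vanish. The terms with
    [t != 0] would then cancel the term [\prod_i #|P i|] at [t = 0], but they are too small. *)
Lemma exists_sum_eq (F : finFieldType) (C : numClosedFieldType) (e : F -> C)
    (I W : finType) (P : I -> {set W}) (phi : I -> W -> F) :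
  add_character e ->
  \sum_(t | t != 0) \prod_i `|\sum_(w in P i) e (t * phi i w)| < \prod_i #|P i|%:R ->
  forall lambda, exists w : I -> W,
    (forall i, w i \in P i) /\ \sum_i phi i (w i) = lambda.
Proof.
move=> he; have [eD e1 e_orth] := he; have e0 := add_character0 he => small lambda.
case: (pickP [pred w : {ffun I -> W} | (w \in family P) && (\sum_i phi i (w i) == lambda)])
  => [w /andP[/familyP wP /eqP wl]|no]; first by exists w.
have : \sum_t e (- (t * lambda)) * \prod_i \sum_(w in P i) e (t * phi i w) = 0.
  under eq_bigr => t _.
    rewrite bigA_distr_big_dep /= big_distrr /=.
    under eq_bigr => w _.
      rewrite -(big_morph _ eD e0) -eD -mulr_sumr.
      have -> : - (t * lambda) + t * \sum_i phi i (w i) = t * (\sum_i phi i (w i) - lambda) by ring.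
      over.
    over.
  rewrite exchange_big /= big1 // => w wP; rewrite e_orth.
  by have := no w; rewrite /= wP /= subr_eq0 => ->; rewrite muln0.
rewrite (bigD1 0) //= mul0r oppr0 e0 mul1r => /eqP; rewrite addrC addr_eq0 => /eqP eqS.
have : `|\sum_(t | t != 0) e (- (t * lambda)) * \prod_i \sum_(w in P i) e (t * phi i w)|
    <= \sum_(t | t != 0) \prod_i `|\sum_(w in P i) e (t * phi i w)|.
  apply: le_trans (ler_norm_sum _ _ _) _; apply: ler_sum => t _.
  by rewrite normrM e1 mul1r normr_prod.
rewrite eqS normrN; have -> : \prod_i \sum_(w in P i) e (0 * phi i w) = \prod_i #|P i|%:R.
  apply: eq_bigr => i _; under eq_bigr do rewrite mul0r e0.
  by rewrite sumr_const.
rewrite ger0_norm; last by apply: prodr_ge0 => i _; apply: ler0n.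
by move=> /le_lt_trans /(_ small); rewrite ltxx.
Qed.

(** For the exponential sum [f] over [X], orthogonality evaluates the correlation at [t], [t'] as
    [#|F| * dilate_card X (t' / t)], so [fourth_moment] bounds the error term by the energy of
    [X]. *)
Lemma four_products_cover (F : finFieldType) (C : numClosedFieldType) (e : F -> C)
    (X A : {set F}) : add_character e ->
  (#|F| ^ 2 * mul_energy X < #|A| ^ 2 * #|X| ^ 4)%N ->
  forall lambda, exists x a : 'I_4 -> F,
    [/\ forall i, x i \in X, forall i, a i \in A & \sum_i x i * a i = lambda].
Proof.
move=> he lt_energy lambda; have [eD e1 e_orth] := he.
pose f z := \sum_(x in X) e (z * x).
have moment : \sum_(t | t != 0) `|\sum_(a in A) f (t * a)| ^+ 4
    <= (#|A| ^ 2 * (#|F| ^ 2 * mul_energy X))%:R.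
  rewrite /mul_energy big_distrr /=.
  under [X in (_ * X)%N]eq_bigr do rewrite -expnMn.
  apply: fourth_moment => t t' t0 t'0.
  have -> : \sum_z f (t * z) * (f (t' * z))^* = (#|F| * dilate_card X (t' / t))%:R; last first.
    by rewrite ger0_norm ?ler0n.
  under eq_bigr => z _.
    rewrite /f rmorph_sum /= mulrC big_distrlr /=.
    under eq_bigr => x' _.
      under eq_bigr => x _.
        rewrite -add_characterN // -eD.
        have -> : - (t' * z * x') + t * z * x = z * (t * x - t' * x') by ring.
        over.
      over.
    over.
  rewrite exchange_big /= natrM /dilate_card -sum1dep_card natr_sum big_distrr /=.
  rewrite [RHS]big_mkcondr /=; apply: eq_bigr => x' x'X.
  rewrite exchange_big /=; under eq_bigr do rewrite e_orth.
  case: ifP => hx.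
    rewrite (bigD1 _ hx) /= big1 ?addr0 => [|x /andP[_ nx]].
      have -> : t * (t' / t * x') - t' * x' = 0 by field.
      by rewrite eqxx muln1 mulr1.
    rewrite (_ : (_ == 0) = false) ?muln0 //; apply/negbTE.
    apply: contra nx; rewrite subr_eq0 => /eqP E; apply/eqP.
    by apply: (mulfI t0); rewrite E; field.
  rewrite big1 // => x xX; rewrite (_ : (_ == 0) = false) ?muln0 //; apply/negP.
  rewrite subr_eq0 => /eqP E; move: hx; rewrite (_ : t' / t * x' = x) ?xX //.
  by apply: (mulfI t0); rewrite E; field.
have [|xa [xaP xa_sum]] := @exists_sum_eq F C e 'I_4 (F * F)%type (fun _ => setX X A)
    (fun _ xa => xa.1 * xa.2) he _ lambda.
  rewrite big_const_ord iter_mulr_1 cardsX.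
  under eq_bigr => t _.
    rewrite big_const_ord iter_mulr_1.
    have -> : \sum_(w in setX X A) e (t * (w.1 * w.2)) = \sum_(a in A) f (t * a).
      rewrite /f exchange_big /= pair_big_dep /=; apply: eq_big => [w|w _].
        by rewrite inE.
      by congr e; ring.
    over.
  apply: le_lt_trans moment _; rewrite -natrX ltr_nat.
  have A_gt0 : (0 < #|A|)%N by case: #|A| lt_energy.
  have -> : ((#|X| * #|A|) ^ 4 = #|A| ^ 2 * (#|A| ^ 2 * #|X| ^ 4))%N.
    by rewrite expnMn mulnC (expnD _ 2 2) mulnA.
  by rewrite ltn_pmul2l ?expn_gt0 ?A_gt0.
exists (fun i => (xa i).1), (fun i => (xa i).2); split=> // i;
  by have := xaP i; rewrite inE => /andP[].
Qed.

(** With [f] the indicator of [B], the fourth moment counts, over all [t != 0], the quadruples of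
    [A] that [t] dilates into [B]. By [fourth_moment] this is less than [#|A| ^ 4], so some
    quadruple is never counted. *)
Lemma exists_no_common_dilate (F : finFieldType) (A B : {set F}) :
  (mul_energy B < #|A| ^ 2)%N ->
  exists a : 'I_4 -> F, (forall i, a i \in A) /\
    forall t, t != 0 -> exists i, t * a i \notin B.
Proof.
move=> lt_energy; pose f (z : F) : algC := (z \in B)%:R.
have moment : \sum_(t | t != 0) `|\sum_(a in A) f (t * a)| ^+ 4
    <= (#|A| ^ 2 * mul_energy B)%:R.
  apply: fourth_moment => t t' t0 t'0.
  rewrite (_ : \sum_z _ = (dilate_card B (t' / t))%:R) ?ger0_norm ?ler0n //.
  rewrite /dilate_card -sum1dep_card natr_sum.
  rewrite (reindex_onto (fun x => x / t) (fun z => z * t)) /=; last first.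
    by move=> z _; rewrite mulfK.
  rewrite [RHS]big_mkcond /= big_mkcond /=; apply: eq_bigr => x _.
  have -> : t * (x / t) = x by field.
  have -> : t' * (x / t) = t' / t * x by field.
  rewrite divfK // eqxx /f conjC_nat.
  by case: (x \in B); case: (_ \in B); rewrite ?mulr1 ?mulr0.
case: (pickP [pred w : {ffun 'I_4 -> F} | (w \in family (fun _ => A)) &&
   [forall t : F, (t != 0) ==> [exists i, t * w i \notin B]]])
   => [w /andP[/familyP wA /forallP nt]|no].
  exists w; split=> // t t0; have := nt t; rewrite t0 /= => /existsP[i hi].
  by exists i.
suff : ((#|A| ^ 4)%:R <= (#|A| ^ 2 * mul_energy B)%:R :> algC).
  rewrite ler_nat leqNgt -[4%N]/(2 + 2)%N expnD ltn_pmul2l ?lt_energy //.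
  by rewrite expn_gt0; case: #|A| lt_energy.
apply: le_trans moment.
have -> : \sum_(t | t != 0) `|\sum_(a in A) f (t * a)| ^+ 4 =
   \sum_(w : {ffun 'I_4 -> F} | w \in family (fun _ => A)) \sum_(t | t != 0) \prod_i f (t * w i).
  rewrite exchange_big /=; apply: eq_bigr => t _.
  transitivity (\prod_(i : 'I_4) \sum_(a in A) f (t * a)); last first.
    by rewrite bigA_distr_big_dep.
  rewrite big_const_ord iter_mulr_1 ger0_norm //.
  by apply: sumr_ge0 => a _; apply: ler0n.
have -> : (#|A| ^ 4)%:R = \sum_(w : {ffun 'I_4 -> F} | w \in family (fun _ => A)) (1 : algC).
  transitivity (\prod_(i : 'I_4) \sum_(a in A) (1 : algC)).
    by rewrite big_const_ord iter_mulr_1 sumr_const natrX.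
  by rewrite bigA_distr_big_dep /=; apply: eq_bigr => w _; rewrite big1.
apply: ler_sum => w wA; have := no w; rewrite /= wA /= => /negbT.
rewrite negb_forall => /existsP[t]; rewrite negb_imply negb_exists => /andP[t0 /forallP tB].
rewrite (bigD1 t) //= big1 => [|i _]; last first.
  by rewrite /f; have := tB i; rewrite negbK => ->.
by rewrite lerDl; apply: sumr_ge0 => t' _; apply: prodr_ge0 => i _; apply: ler0n.
Qed.

(** * Exponential sums modulo p and covering with a long interval *)

Definition cis (R : realType) (x : R) : R[i] := Complex (cos x) (sin x).

Lemma cisD (R : realType) (x y : R) : cis (x + y) = cis x * cis y.
Proof.
apply/eqP; rewrite eq_complex /= cosD sinD eqxx /=; apply/eqP; ring.
Qed.

Lemma norm_cis (R : realType) (x : R) : `|cis x| = 1.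
Proof. by rewrite normc_def /= cos2Dsin2 sqrtr1. Qed.

Definition Fp_root (R : realType) (p : nat) : R[i] := cis (pi *+ 2 / p%:R).

Definition Fp_char (R : realType) (p : nat) (s : 'F_p) : R[i] := Fp_root R p ^+ s.

Lemma Fp_rootX (R : realType) p n : Fp_root R p ^+ n = cis (pi *+ 2 / p%:R * n%:R).
Proof.
elim: n => [|n IHn].
  by rewrite expr0 mulr0; apply/eqP; rewrite eq_complex /= cos0 sin0 !eqxx.
by rewrite exprSr IHn -cisD -natr1 mulrDr mulr1.
Qed.

Lemma Fp_rootp (R : realType) p : prime p -> Fp_root R p ^+ p = 1.
Proof.
move=> p_pr; rewrite Fp_rootX divfK ?pnatr_eq0 -?lt0n ?prime_gt0 //.
by apply/eqP; rewrite eq_complex /= cos2pi sin2pi !eqxx.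
Qed.

Lemma Fp_root_neq1 (R : realType) p : prime p -> Fp_root R p != 1.
Proof.
move=> p_pr; apply/eqP => /(congr1 (@complex.Re R)) /= cos1.
have pi_gt0 := pi_gt0 R.
have p_gt0 : 0 < p%:R :> R by rewrite ltr0n prime_gt0.
have x_gt0 : 0 < pi *+ 2 / p%:R :> R by rewrite divr_gt0 // mulrn_wgt0.
suff x0 : pi *+ 2 / p%:R = 0 :> R by rewrite x0 ltxx in x_gt0.
apply: cos_inj; last by rewrite cos0.
  by rewrite in_itv /= ltW //= ler_pdivrMr // -[pi *+ 2]mulr_natr ler_pM2l // ler_nat prime_gt1.
by rewrite in_itv /= lexx ltW.
Qed.

Lemma Fp_char_nat (R : realType) p n : prime p ->
  Fp_char R (n%:R : 'F_p) = Fp_root R p ^+ n.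
Proof.
by move=> p_pr; rewrite /Fp_char val_Fp_nat // expr_mod // Fp_rootp.
Qed.

Lemma Fp_char_add_character (R : realType) p : prime p -> add_character (@Fp_char R p).
Proof.
move=> p_pr.
have eD : {morph @Fp_char R p : x y / x + y >-> x * y}.
  move=> x y; rewrite -[x in LHS]natr_Zp -[y in LHS]natr_Zp -natrD Fp_char_nat //.
  by rewrite exprD.
split=> // [x|x]; first by rewrite /Fp_char normrX norm_cis expr1n.
have [->|x0] := eqVneq x 0.
  under eq_bigr do rewrite mulr0 /Fp_char expr0.
  by rewrite muln1 sumr_const.
rewrite muln0; set S := \sum_z _.
have SE : S = \sum_(z : 'F_p) Fp_char R z.
  by apply/esym; rewrite (reindex_inj (mulIf x0)).
have : (Fp_root R p - 1) * S = 0.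
  rewrite mulrBl mul1r; apply/eqP; rewrite subr_eq0 {1}SE big_distrr /=; apply/eqP.
  have -> : Fp_root R p = Fp_char R (1 : 'F_p) by rewrite -[RHS](Fp_char_nat R 1 p_pr).
  under eq_bigr do rewrite -eD.
  by rewrite SE; apply/esym; rewrite (reindex_inj (addrI 1)).
by move/eqP; rewrite mulf_eq0 subr_eq0 (negPf (Fp_root_neq1 R p_pr)) => /eqP.
Qed.

(** The angle lies between a quarter and three quarters of a turn, where the cosine is at most 0. *)
Lemma Fp_root_far (R : realType) p n : prime p -> (p <= 4 * n <= 3 * p)%N ->
  1 <= `|Fp_root R p ^+ n - 1|.
Proof.
move=> p_pr /andP[le1 le2]; apply: le_trans (normc_ge_Re _).
rewrite Fp_rootX (_ : 1 = real_complex R 1) // lecR /=; set x := _ * n%:R.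
have p_gt0 : 0 < p%:R :> R by rewrite ltr0n prime_gt0.
have pi_gt0 := pi_gt0 R.
have cos_le0 : cos x <= 0.
  have -> : x = (x - pi) + pi by rewrite subrK.
  rewrite cosDpi oppr_le0; apply: cos_ge0_pihalf.
  have le1' : p%:R <= 4 * n%:R :> R by rewrite -natrM ler_nat.
  have le2' : 4 * n%:R <= 3 * p%:R :> R by rewrite -!natrM ler_nat.
  have xE : x = pi * (4 * n%:R / p%:R) / 2 by rewrite /x; field; rewrite gt_eqF.
  have h1 : 1 <= 4 * n%:R / p%:R :> R by rewrite ler_pdivlMr // mul1r.
  have h2 : 4 * n%:R / p%:R <= 3 :> R by rewrite ler_pdivrMr.
  by rewrite xE; move: (4 * n%:R / p%:R) h1 h2 => y h1 h2; apply/andP; split; nra.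
by rewrite ler0_norm; lra.
Qed.

(** Some power [z ^+ n] with [s * n <= p] is at distance at least 1 from 1, while that distance is
    at most [n] times the one of [z]. No estimate of the sine near 0 is needed. *)
Lemma Fp_root_dist (R : realType) p s : prime p -> (0 < s)%N -> (2 * s <= p)%N ->
  s%:R <= p%:R * `|Fp_root R p ^+ s - 1|.
Proof.
move=> p_pr s_gt0 les; set z := Fp_root R p ^+ s.
(* The least [n] with [p < 4 * s * n]; then [4 * s * n <= p + 4 * s <= 3 * p]. *)
pose n := (p %/ (4 * s)).+1.
have lt1 : (p < 4 * s * n)%N by rewrite mulnC ltn_ceil // muln_gt0.
have le2 : (4 * s * n <= p + 4 * s)%N.
  by rewrite mulnS addnC leq_add2r mulnC leq_trunc_div.
have := @Fp_root_far R p (s * n) p_pr; rewrite mulnA ltnW //=.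
rewrite exprM -/z => /(_ ltac:(lia)).
have norm_z : `|z| = 1 by rewrite normrX norm_cis expr1n.
have : `|z ^+ n - 1| <= n%:R * `|z - 1|.
  rewrite subrX1 normrM mulrC ler_wpM2r //; apply: le_trans (ler_norm_sum _ _ _) _.
  under eq_bigr do rewrite normrX norm_z expr1n.
  by rewrite sumr_const card_ord.
move=> le_n /le_trans /(_ le_n) le_1.
apply: le_trans (_ : s%:R * (n%:R * `|z - 1|) <= _); first by rewrite ler_peMr ?ler0n.
rewrite mulrA ler_wpM2r // -natrM ler_nat; lia.
Qed.

(** The sum times [z - 1] has norm at most 2, and [z] is at distance at least [b / p] from 1 by
    [Fp_root_dist], applied to [p - s] when [s] exceeds [p / 2]. *)
Lemma norm_geometric_sum (R : realType) p (s : 'F_p) (b H : nat) : prime p ->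
  (b < s)%N -> (s + b < p)%N ->
  b%:R * `|\sum_(h < H) Fp_char R (s * h%:R)| <= (2 * p)%:R.
Proof.
move=> p_pr lt1 lt2; have [eD e1 _] := Fp_char_add_character R p_pr.
have lesp : (s <= p)%N by apply: leq_trans (ltnW lt2); apply: leq_addr.
pose z := Fp_root R p ^+ s.
have norm_z : `|z| = 1 by rewrite normrX norm_cis expr1n.
have -> : \sum_(h < H) Fp_char R (s * h%:R) = \sum_(h < H) z ^+ h.
  by apply: eq_bigr => h _; rewrite -{1}[s]natr_Zp -natrM Fp_char_nat // exprM.
have le_2 : `|z - 1| * `|\sum_(h < H) z ^+ h| <= 2.
  rewrite -normrM -subrX1; apply: le_trans (ler_normB _ _) _.
  by rewrite normrX norm_z expr1n normr1.
have le_b : b%:R <= p%:R * `|z - 1|.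
  have [le|lt] := leqP (2 * s) p.
    apply: le_trans (Fp_root_dist R p_pr _ le); first by rewrite ler_nat ltnW.
    by apply: leq_ltn_trans lt1.
  have -> : `|z - 1| = `|Fp_root R p ^+ (p - s) - 1|.
    rewrite -[LHS]mul1r -[X in X * _](_ : `|Fp_root R p ^+ (p - s)| = 1); last first.
      by rewrite normrX norm_cis expr1n.
    by rewrite -normrM mulrBr mulr1 /z -exprD subnK // Fp_rootp // distrC.
  have lt3 : (b < p - s)%N by rewrite ltn_subRL.
  apply: le_trans (Fp_root_dist R p_pr _ _); first by rewrite ler_nat ltnW.
    exact: leq_ltn_trans lt3.
  by rewrite mulnBr leq_subLR mul2n -addnn leq_add2r ltnW.
apply: le_trans (ler_wpM2r (normr_ge0 _) le_b) _.
by rewrite -mulrA natrM [2%:R * _]mulrC; apply: ler_wpM2l le_2; apply: ler0n.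
Qed.

(** The [a i] are those of [exists_no_common_dilate] for [[-b, b]], and each [x i] is [x0] plus [l]
    integers below [H]. For [t != 0] some [t * a i] is outside [[-b, b]], where the geometric sum is
    at most [H / q]; its [l]-th power saves [q ^ l > p], which pays for the trivial summation over
    [t]. *)
Lemma long_interval_cover (R : realType) p (A : {set 'F_p}) (M b H l q : nat) :
  prime p -> (0 < b)%N -> (l * H <= M)%N -> (0 < l)%N -> (0 < H)%N ->
  (2 * p * q <= b * H)%N -> (p < q ^ l)%N -> 0 \notin A ->
  (mul_energy ([set (- b%:R + i%:R : 'F_p)%R | i : 'I_(2 * b).+1] :\ 0%R) < #|A| ^ 2)%N ->
  forall x0 lambda : 'F_p, exists x a : 'I_4 -> 'F_p,
    [/\ forall i, x i \in [set x0 + j%:R | j : 'I_M], forall i, a i \in A &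
        \sum_i x i * a i = lambda].
Proof.
move=> p_pr b_gt0 leM l_gt0 H_gt0 le_pq lt_pq A0 /exists_no_common_dilate[a [aA a_dil]] x0 lambda.
have he := Fp_char_add_character R p_pr.
pose D (t : 'F_p) : R[i] := `|\sum_(h in [set: 'I_H]) Fp_char R (t * h%:R)|.
have D_le t : D t <= H%:R.
  apply: le_trans (ler_norm_sum _ _ _) _; have [_ e1 _] := he.
  by under eq_bigr do rewrite e1; rewrite sumr_const cardsT card_ord.
have D_ge0 t : 0 <= D t by apply: normr_ge0.
have D_far (t : 'F_p) : t != 0 -> exists i, q%:R * D (t * a i) <= H%:R.
  move=> t0; have [i hi] := a_dil t t0; exists i.
  have ta0 : t * a i != 0 by rewrite mulf_neq0 //; apply: contraNneq A0 => <-.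
  move: (t * a i : 'F_p) hi ta0 => s; rewrite in_setD1 => hs s0; rewrite s0 /= in hs.
  (* Otherwise [s] would be in the interval, at index [b + s] if it is small and at index
     [s + b - p] if it is close to [p]. *)
  have [lt1 lt2] : (b < s)%N /\ (s + b < p)%N.
    have ltsp : (s < p)%N by rewrite -[X in (_ < X)%N](Fp_cast p_pr) ltn_ord.
    split; rewrite ltnNge; apply: contra hs => les; apply/imsetP.
      have lt_i : (b + s < (2 * b).+1)%N by rewrite ltnS mul2n -addnn leq_add2l.
      by exists (Ordinal lt_i) => //=; rewrite natrD addrA addNr add0r natr_Zp.
    have lt_i : (s + b - p < (2 * b).+1)%N.
      by rewrite ltnS leq_subLR mul2n -addnn addnA leq_add2r (leq_trans (ltnW ltsp)) ?leq_addr.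
    exists (Ordinal lt_i) => //=; rewrite natrB // natrD natr_Zp.
    have -> : p%:R = 0 :> 'F_p by rewrite -(@natr_Zp _ (p%:R)) val_Fp_nat // modnn.
    by rewrite subr0 addrCA addNr addr0.
  have le_D : b%:R * D s <= (2 * p)%:R.
    rewrite /D (eq_bigl xpredT) => [|h]; last by rewrite inE.
    exact: norm_geometric_sum.
  have bq : (0 < b%:R :> R[i]) by rewrite ltr0n.
  rewrite -(ler_pM2l bq) mulrCA -natrM.
  apply: le_trans (_ : q%:R * (2 * p)%:R <= _); first by rewrite ler_wpM2l ?ler0n.
  by rewrite -natrM ler_nat mulnC.
pose phi (ij : 'I_4 * 'I_l) (h : 'I_H) : 'F_p := a ij.1 * h%:R.
have [|w [_ w_sum]] := exists_sum_eq (P := fun _ : 'I_4 * 'I_l => [set: 'I_H]) (phi := phi) he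
    _ (lambda - \sum_i x0 * a i).
  have q_gt0 : 0 < (q ^ l)%:R :> R[i] by rewrite ltr0n (leq_ltn_trans _ lt_pq).
  have prodE (t : 'F_p) : \prod_(ij : 'I_4 * 'I_l) `|\sum_(w in [set: 'I_H]) Fp_char R (t * phi ij w)|
      = \prod_(i < 4) D (t * a i) ^+ l.
    rewrite -(pair_bigA _ (fun i (j : 'I_l) =>
      `|\sum_(w in [set: 'I_H]) Fp_char R (t * phi (i, j) w)|)) /=.
    apply: eq_bigr => i _; rewrite /phi /=.
    under eq_bigr => j _.
      under eq_bigr do rewrite mulrA.
      over.
    by rewrite big_const_ord iter_mulr_1.
  have H_prod : \prod_(ij : 'I_4 * 'I_l) #|[set: 'I_H]|%:R = (H%:R ^+ l) ^+ 4 :> R[i].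
    by rewrite cardsT card_ord -(pair_bigA _ (fun _ _ => H%:R)) /= !big_const_ord !iter_mulr_1.
  have term (t : 'F_p) : t != 0 -> (q ^ l)%:R * \prod_(i < 4) D (t * a i) ^+ l <= (H%:R ^+ l) ^+ 4.
    move=> t0; have [i hi] := D_far t t0.
    rewrite (bigD1 i) //= mulrA natrX -exprMn exprS; apply: ler_pM.
    - by rewrite exprn_ge0 // mulr_ge0 ?ler0n.
    - by apply: prodr_ge0 => j _; apply: exprn_ge0.
    - by apply: lerXn2r; rewrite ?nnegrE ?mulr_ge0 ?ler0n.
    have -> : (H%:R ^+ l) ^+ 3 = \prod_(j < 4 | j != i) (H%:R ^+ l) :> R[i].
      by rewrite prodr_const cardC1 card_ord.
    by apply: ler_prod => j _; rewrite exprn_ge0 //= lerXn2r ?nnegrE ?ler0n.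
  rewrite H_prod -(ltr_pM2l q_gt0) big_distrr /=.
  under eq_bigr do rewrite prodE.
  apply: le_lt_trans (_ : \sum_(t : 'F_p | t != 0) (H%:R ^+ l) ^+ 4 < _).
    by apply: ler_sum => t t0; apply: term.
  rewrite sumr_const -[X in X < _]mulr_natl ltr_pM2r ?exprn_gt0 ?ltr0n //.
  rewrite ltr_nat; apply: leq_ltn_trans lt_pq.
  by rewrite -[X in (_ <= X)%N](card_Fp p_pr) max_card.
have lt_w i : (\sum_(j < l) w (i, j) < M)%N.
  apply: leq_trans leM; apply: (@leq_ltn_trans (\sum_(j < l) H.-1)).
    by apply: leq_sum => j _; rewrite -ltnS prednK.
  by rewrite sum_nat_const card_ord ltn_pmul2l // ltn_predL.
exists (fun i => x0 + (\sum_(j < l) w (i, j))%:R), a; split=> // [i|].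
  by apply/imsetP; exists (Ordinal (lt_w i)).
have -> : lambda = \sum_i x0 * a i + \sum_ij phi ij (w ij) by rewrite w_sum addrC subrK.
have -> : \sum_ij phi ij (w ij) = \sum_i \sum_j phi (i, j) (w (i, j)).
  by rewrite pair_bigA; apply: eq_bigr => -[].
rewrite -big_split /=.
apply: eq_bigr => i _; rewrite mulrDl natr_sum; congr (_ + _).
by rewrite big_distrl /=; apply: eq_bigr => j _; rewrite /phi /= mulrC.
Qed.

(** * Intervals and fractions *)

Definition interval p (a : 'F_p) (N : nat) : {set 'F_p} := [set a + i%:R | i : 'I_N].

Lemma mem_interval p (a : 'F_p) N i : (i < N)%N -> a + i%:R \in interval a N.
Proof. by move=> ltiN; apply/imsetP; exists (Ordinal ltiN). Qed.

Lemma addr_natr_inj p (a : 'F_p) N : prime p -> (N <= p)%N ->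
  injective (fun i : 'I_N => a + i%:R).
Proof.
move=> p_pr leNp i j /addrI /(@natr_Fp_inj p) -/(_ p_pr) E; apply: val_inj.
by move: E; rewrite !modn_small // (leq_trans (ltn_ord _) leNp).
Qed.

Lemma card_interval p (a : 'F_p) N : prime p -> (N <= p)%N -> #|interval a N| = N.
Proof. by move=> p_pr leNp; rewrite card_imset ?card_ord //; apply: addr_natr_inj. Qed.

(** If 0 is in the interval, the longer piece on one side of it is kept. It is nonempty since the
    interval is not the singleton of 0, and the point 0 itself accounts for the factor 3:
    [N <= 2 * m + 1 <= 3 * m]. *)
Lemma nonzero_subinterval p (I : {set 'F_p}) : prime p -> is_nonzero_interval I ->
  exists a m, [/\ (0 < m <= p)%N, (#|I| <= 3 * m)%N, interval a m \subset I &
    0 \notin interval a m].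
Proof.
move=> p_pr [[a [N [/andP[N_gt0 leNp] I_eq]]] I_neq0].
have IE : I = interval a N by [].
have cardI : #|I| = N by rewrite IE card_interval.
(* The index at which the progression from [a] reaches 0. *)
pose z := nat_of_ord (- a).
have ltzp : (z < p)%N by rewrite -[X in (_ < X)%N](Fp_cast p_pr) ltn_ord.
have zE i : (i < p)%N -> (a + i%:R == 0) = (i == z).
  move=> ltip; rewrite addrC addr_eq0; apply/eqP/eqP => [E|->]; last by rewrite natr_Zp.
  by rewrite /z -E val_Fp_nat // modn_small.
have sub_z b m : (b + m <= N)%N -> (z < b)%N || (b + m <= z)%N ->
    interval (a + b%:R) m \subset I /\ 0 \notin interval (a + b%:R) m.
  move=> le_bm z_out; split.
    apply/subsetP => _ /imsetP[i _ ->]; rewrite IE -addrA -natrD; apply: mem_interval.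
    by apply: leq_trans le_bm; rewrite ltn_add2l.
  apply/imsetP => -[i _] /esym/eqP; rewrite -addrA -natrD zE.
    by have := ltn_ord i => lti /eqP E; move: z_out; rewrite -E; lia.
  by apply: leq_trans leNp; apply: leq_trans le_bm; rewrite ltn_add2l.
have [leNz|ltzN] := leqP N z.
  have [||s1 s2] := sub_z 0%N N; rewrite ?add0n ?leNz ?orbT //.
  by exists (a + 0%:R), N; split=> //; rewrite ?N_gt0 // cardI; lia.
have N_gt1 : (1 < N)%N.
  rewrite ltnNge; apply/negP => N_le1; apply: I_neq0; rewrite IE.
  have N1 : N = 1%N by apply/eqP; rewrite eqn_leq N_le1.
  apply/setP => x; rewrite !inE; apply/imsetP/eqP => [[i _ ->]|->].
    apply/eqP; rewrite zE; last by apply: leq_trans leNp.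
    by have := ltn_ord i; lia.
  have lt0 : (0 < N)%N by lia.
  exists (Ordinal lt0) => //=; apply/esym/eqP; rewrite zE ?prime_gt0 //.
  by move: ltzN N1; clear; lia.
have [le1|lt1] := leqP (N - z.+1) z.
  have [||s1 s2] := sub_z 0%N z; rewrite ?add0n ?leqnn ?orbT ?(ltnW ltzN) //.
  by exists (a + 0%:R), z; split=> //; rewrite ?cardI; lia.
have [||s1 s2] := sub_z z.+1 (N - z.+1)%N; rewrite ?ltnSn ?subnKC //.
by exists (a + z.+1%:R), (N - z.+1)%N; split=> //; rewrite ?cardI; lia.
Qed.

Lemma enum_subset (F : nmodType) (T : finType) (W : {set T}) k : #|W| = k ->
  exists w : 'I_k -> T, forall g : T -> F, \sum_(v in W) g v = \sum_r g (w r).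
Proof.
by move=> <-; exists enum_val => g; rewrite big_enum_val.
Qed.

(** If [a + i = b * u] then [u * (b + v) = a + (i + u * v)], which stays in the interval since
    [n + U * V <= N]. Thus each [xi j * al j] expands into [k] fractions with the same numerator. *)
Lemma assemble_fractions p k (I : {set 'F_p}) (a b : 'F_p) (N n U V : nat)
    (xi al : 'I_4 -> 'F_p) :
  prime p -> (U < p)%N -> (n + U * V <= N)%N -> 0 \notin interval a N ->
  (forall j, exists x (i : 'I_n) (u : 'I_U),
     [/\ x \in I, a + i%:R = b * u.+1%:R & xi j = x / u.+1%:R]) ->
  (forall j, exists2 W : {set 'I_V}, #|W| = k & al j = \sum_(v in W) (b + v.+1%:R)^-1) ->
  exists x y : 'I_(4 * k) -> 'F_p,
    [/\ forall i, x i \in I, forall i, y i \in interval a N, forall i, y i <> 0 &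
        \sum_(i < 4 * k) x i / y i = \sum_j xi j * al j].
Proof.
move=> p_pr ltUp le_N J0 hxi hal.
have term j : exists xy : 'I_k -> 'F_p * 'F_p,
    [/\ forall r, (xy r).1 \in I, forall r, (xy r).2 \in interval a N &
        \sum_r (xy r).1 / (xy r).2 = xi j * al j].
  have [x [i [u [xI Eb Exi]]]] := hxi j; have [W /(enum_subset 'F_p)[w wE] Eal] := hal j.
  have u_neq0 : u.+1%:R != 0 :> 'F_p.
    by apply: natr_Fp_neq0 => //=; apply: leq_ltn_trans ltUp.
  pose y (v : 'I_V) := a + (i + u.+1 * v.+1)%:R.
  have yE v : y v = u.+1%:R * (b + v.+1%:R).
    by rewrite /y natrD natrM addrA Eb; ring.
  have yJ v : y v \in interval a N.
    apply: mem_interval; apply: leq_trans le_N; rewrite -addSn; apply: leq_add => //.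
    by apply: leq_mul.
  exists (fun r => (x, y (w r))); split=> //=.
  rewrite Exi Eal wE big_distrr /=; apply: eq_bigr => r _.
  by rewrite yE invfM mulrA.
have [xy xyP] := fin_all_exists term.
pose E : #|{: 'I_4 * 'I_k}| = (4 * k)%N := etrans (card_prod _ _) (congr2 muln (card_ord 4) (card_ord k)).
pose d (i : 'I_(4 * k)) : 'I_4 * 'I_k := enum_val (cast_ord (esym E) i).
have d_bij : bijective d.
  exists (fun jr => cast_ord E (enum_rank jr)) => [i|jr].
    by rewrite /d enum_valK cast_ordKV.
  by rewrite /d cast_ordK enum_rankK.
exists (fun i => (xy (d i).1 (d i).2).1), (fun i => (xy (d i).1 (d i).2).2).
split=> [i|i|i|]; first by have [] := xyP (d i).1.
- by have [] := xyP (d i).1.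
- by move=> y0; have [_ /(_ (d i).2)] := xyP (d i).1; rewrite y0 (negPf J0).
rewrite -(reindex d (P := xpredT) (F := fun jr => (xy jr.1 jr.2).1 / (xy jr.1 jr.2).2)) /=; last first.
  exact: onW_bij.
rewrite -(pair_bigA _ (fun j r => (xy j r).1 / (xy j r).2)) /=.
by apply: eq_bigr => j _; have [] := xyP j.
Qed.

(** The popular ratios serve as [B] in [exists_many_reciprocal_sums]. The last clause says that
    [#|A|] is at least [min('C(V, k), #|B|) / (2 * k + 1)], through any common lower bound [T] of
    the binomial and of the estimate for [#|B|]. *)
Lemma exists_reciprocal_sumset p k (a : 'F_p) (N n U V : nat) :
  prime p -> (0 < U <= n)%N -> (U < p)%N -> (V < p)%N -> (k <= V)%N ->
  (n + U * V <= N)%N -> 0 \notin interval a N ->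
  exists b (A : {set 'F_p}),
  [/\ (n * U <= 2 * p * ratio_card n U a b)%N, (0 < #|A|)%N,
      forall al, al \in A ->
        exists2 W : {set 'I_V}, #|W| = k & al = \sum_(v in W) (b + v.+1%:R)^-1 &
      forall T, (T <= 'C(V, k))%N ->
        (16 * ((2 * n * U) %/ p).+1 * (trunc_log 2 U).+2 * T <= n * U)%N ->
        (T <= (2 * k + 1) * #|A|)%N].
Proof.
move=> p_pr /andP[U_gt0 leUn] ltUp ltVp lekV le_N J0.
set B := [set b | (n * U <= 2 * p * ratio_card n U a b)%N].
have nU_gt0 : (0 < n * U)%N by rewrite muln_gt0 U_gt0 (leq_trans U_gt0).
have cardB := card_popular_ratios a p_pr (introT andP (conj U_gt0 leUn)) ltUp.
rewrite -/B in cardB.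
pose c (v : 'I_V) : 'F_p := v.+1%:R.
have c_inj : injective c.
  move=> v v' /(@natr_Fp_inj p) -/(_ p_pr); rewrite !modn_small; first by case=> /val_inj.
  - by apply: leq_ltn_trans ltVp.
  - by apply: leq_ltn_trans ltVp.
have B_gt0 : (0 < #|B|)%N.
  by rewrite lt0n; apply/eqP => B0; move: cardB; rewrite B0 muln0 leqNgt nU_gt0.
have C_gt0 : (0 < 'C(#|'I_V|, k))%N by rewrite card_ord bin_gt0.
(* A popular ratio has a representation [a + i = b * u], so [b + v = 0] would put [0 = u * (b + v)]
   in the interval. *)
have nzB b v : b \in B -> b + c v != 0.
  rewrite inE => rho_b; have : (0 < ratio_card n U a b)%N.
    by rewrite lt0n; apply/eqP => r0; move: rho_b; rewrite r0 muln0 leqNgt nU_gt0.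
  rewrite card_gt0 => /set0Pn[[i u]]; rewrite inE /= => /eqP Eb.
  apply: contraNneq J0 => bv0.
  have -> : 0 = a + (i + u.+1 * v.+1)%:R.
    by rewrite natrD natrM addrA Eb [b * _]mulrC -mulrDr bv0 mulr0.
  apply: mem_interval; apply: leq_trans le_N; rewrite -addSn; apply: leq_add => //.
  by apply: leq_mul.
have [b bB le_A] := exists_many_reciprocal_sums c_inj B_gt0 C_gt0 nzB.
move: le_A; set A := imset _ _; rewrite !card_ord => le_A.
exists b, A; split.
- by move: bB; rewrite inE.
- rewrite lt0n; apply/eqP => A0; move: le_A; rewrite A0 mul0n leqn0 muln_eq0.
  by rewrite !eqn0Ngt B_gt0 bin_gt0 lekV.
- by move=> al /imsetP[W]; rewrite inE => /eqP cW ->; exists W.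
move=> T leTC leTU.
have leTB : (T <= #|B|)%N.
  rewrite -(@leq_pmul2l (16 * ((2 * n * U) %/ p).+1 * (trunc_log 2 U).+2)%N) ?muln_gt0 //.
  exact: leq_trans leTU cardB.
rewrite leqNgt; apply/negP => ltA.
have : (0 < 'C(V, k))%N by rewrite bin_gt0.
move: le_A leTC leTB ltA B_gt0; clear.
move: #|A| #|B| 'C(V, k) => x y C; clear.
move=> h1 h2 h3 h4 h5 h6.
have [leyC|ltCy] := leqP y C.
  have : (x * (y + 2 * k * C) <= (2 * k + 1) * x * C)%N by nia.
  have : ((2 * k + 1) * x * C < C * y)%N by nia.
  lia.
have : (x * (y + 2 * k * C) <= (2 * k + 1) * x * y)%N by nia.
have : ((2 * k + 1) * x * y < C * y)%N by nia.
lia.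
Qed.

(** * Covering by products and by fractions, under integer inequalities *)

Local Open Scope nat_scope.

Lemma expn_le_ffact n m : m <= n -> (n - m) ^ m <= n ^_ m.
Proof.
elim: m n => [|m IHm] [|n] // le_mn; rewrite ffactSS expnS subSS.
by apply: leq_mul; [rewrite (leq_trans (leq_subr _ _)) | apply: IHm].
Qed.

Lemma expn_le_bin V k : 2 * k <= V -> V ^ k <= 2 ^ k * k`! * 'C(V, k).
Proof.
move=> leV; rewrite -mulnA [k`! * _]mulnC bin_ffact.
apply: (@leq_trans (2 ^ k * (V - k) ^ k)).
  by rewrite -expnMn; have [->//|k_gt0] := posnP k; rewrite leq_exp2r //; lia.
by rewrite leq_mul2l expn_le_ffact ?orbT //; lia.
Qed.

Lemma exists_root j x : 0 < j -> exists V, V ^ j <= x < V.+1 ^ j.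
Proof.
move=> j_gt0; have exP : exists V, V ^ j <= x by exists 0; rewrite exp0n.
have ubP V : V ^ j <= x -> V <= x.
  by move=> h; apply: leq_trans h; rewrite -{1}[V]expn1; case: V => [|V]; rewrite ?exp0n // leq_pexp2l.
case: (ex_maxnP exP ubP) => V hV maxV; exists V; rewrite hV ltnNge.
by apply/negP => /maxV; rewrite ltnn.
Qed.

(** [D] measures the excess of [m ^ 2] over [p], and [q] absorbs the logarithm. The quotient by [p]
    is at most [2 * D], its successor at most [3 * D], hence the constant [52 = 4 + 16 * 3]. *)
Lemma mul_energy_interval_le p m (a : 'F_p) D q : prime p -> 0 < m <= p ->
  52 * (trunc_log 2 p).+3 <= q -> 0 < D -> m * m <= D * p ->
  mul_energy (interval a m :\ 0%R) <= D * q * (m * m).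
Proof.
move=> p_pr /andP[m_gt0 lemp] hq D_gt0 le_D.
apply: leq_trans (mul_energy_interval m a p_pr) _.
have p_gt0 := prime_gt0 p_pr.
have le_K : (2 * m * m) %/ p <= 2 * D.
  rewrite -(mulnK (2 * D) p_gt0); apply: leq_div2r.
  by rewrite -[2 * m * m]mulnA -mulnA leq_mul2l.
have le_L : (trunc_log 2 m).+2 <= (trunc_log 2 p).+3.
  by rewrite !ltnS leqW // leq_trunc_log.
have -> : m ^ 2 * 2 ^ 2 = 4 * (m * m) by rewrite -mulnn; lia.
move: le_K le_L hq D_gt0; clear.
move: (_ %/ p) (trunc_log 2 m) (trunc_log 2 p) => K L1 L2 le_K le_L hq D_gt0.
have h1 : K.+1 * L1.+2 <= 3 * D * L2.+3 by apply: leq_mul => //; lia.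
have h2 : 4 + 16 * (K.+1 * L1.+2) <= D * q.
  apply: (@leq_trans (D * (52 * L2.+3))); last by rewrite leq_mul2l hq orbT.
  have : D <= D * L2.+3 by rewrite leq_pmulr.
  by move: h1; rewrite -[3 * D * _]mulnA mulnCA; move: (D * L2.+3) (K.+1 * _) => *; lia.
apply: leq_trans (leq_mul h2 (leqnn (m * m))).
by apply: eq_leq; move: (K.+1) (L1.+2) => y z; ring.
Qed.

(** Up to length [sqrt p] the interval itself has small energy and [four_products_cover] applies.
    Beyond that, the energy of the dual interval of length about [p / M] is used, through
    [long_interval_cover]. *)
Lemma interval_products_cover (R : realType) p q l M (a0 : 'F_p) (A : {set 'F_p}) :
  prime p -> 52 * (trunc_log 2 p).+3 <= q -> 0 < l <= q -> p < q ^ l -> q ^ 6 <= p ->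
  0 < M <= p -> 0%R \notin interval a0 M -> 0%R \notin A -> p * q ^ 7 <= M * #|A| ->
  forall lambda : 'F_p, exists x a : 'I_4 -> 'F_p,
    [/\ forall i, x i \in interval a0 M, forall i, a i \in A & \sum_i x i * a i = lambda]%R.
Proof.
move=> p_pr hq /andP[l_gt0 lelq] lt_pq le_qp /andP[M_gt0 leMp] I0 A0 leMA.
have p_gt0 := prime_gt0 p_pr.
have q_gt : 52 < q by apply: leq_trans hq; rewrite mulnS; lia.
have q_gt0 : 0 < q by lia.
have [leM|ltM] := leqP (M * M) p.
  apply: (four_products_cover (Fp_char_add_character R p_pr)).
  rewrite card_Fp // card_interval //.
  have E : mul_energy (interval a0 M) <= q * (M * M).
    have := @mul_energy_interval_le p M a0 1 q p_pr.
    rewrite M_gt0 leMp /= !mul1n => /(_ isT hq isT leM); apply: leq_trans.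
    have -> // : interval a0 M :\ 0%R = interval a0 M.
    by apply/setP => x; rewrite in_setD1; case: eqVneq => //= ->; rewrite (negPf I0).
  apply: (@leq_ltn_trans (p ^ 2 * (q * (M * M)))); first by rewrite leq_mul2l E orbT.
  have lt2 : p ^ 2 * q < (M * #|A|) ^ 2.
    apply: (@leq_trans ((p * q ^ 7) ^ 2)); last by rewrite leq_sqr.
    rewrite expnMn ltn_pmul2l ?expn_gt0 ?p_gt0 // -expnM -{1}[q]expn1.
    by rewrite ltn_exp2l //; lia.
  have -> : p ^ 2 * (q * (M * M)) = p ^ 2 * q * (M * M) by lia.
  have -> : #|A| ^ 2 * M ^ 4 = (M * #|A|) ^ 2 * (M * M).
    by rewrite expnMn (expnD M 2 2) !mulnn; lia.
  by rewrite ltn_pmul2r // muln_gt0 M_gt0.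
have lt_q3M : q ^ 3 < M.
  rewrite -ltn_sqr -[M ^ 2]mulnn; apply: leq_ltn_trans ltM.
  by rewrite -expnM.
have leqM : q <= M.
  by apply: leq_trans (ltnW lt_q3M); rewrite -{1}[q]expn1 leq_pexp2l.
(* [b] is just large enough for [2 * p * q <= b * H]. The dual length then satisfies
   [m * M <= p * q ^ 3], so its energy is at most [q ^ 7 * m ^ 2], below [#|A| ^ 2] by the
   hypothesis on [M * #|A|]. *)
pose H := M %/ l; pose b := (2 * p * q %/ H).+1; pose m := (2 * b).+1.
have H_gt0 : 0 < H by rewrite divn_gt0 // (leq_trans lelq).
have le_lH : l * H <= M by rewrite mulnC leq_trunc_div.
have leMH : M <= 2 * q * H.
  have : M < l * H.+1 by rewrite mulnC ltn_ceil.
  rewrite mulnS => ltMl; have : l * H <= q * H by rewrite leq_mul2r lelq orbT.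
  have : l <= l * H by rewrite leq_pmulr.
  by move: ltMl; rewrite -mulnA; move: (l * H) (q * H); clear; lia.
have leHp : H <= p by apply: leq_trans leMp; apply: leq_div.
have lt_bH : 2 * p * q <= b * H by apply: ltnW; rewrite ltn_ceil.
have le_bH : b * H <= 2 * p * q + H.
  by rewrite /b mulSn addnC leq_add2r leq_trunc_div.
have le_mM : m * M <= p * q ^ 3.
  apply: (@leq_trans (m * (2 * q * H))); first by rewrite leq_mul2l leMH orbT.
  apply: (@leq_trans (6 * q * (b * H))).
    have -> : m * (2 * q * H) = 2 * m * (q * H) by lia.
    have -> : 6 * q * (b * H) = 6 * b * (q * H) by lia.
    by rewrite leq_mul2r /m /b; apply/orP; right; lia.
  apply: (@leq_trans (6 * q * (3 * p * q))).
    rewrite leq_mul2l; apply/orP; right; apply: leq_trans le_bH _.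
    have : p <= p * q by rewrite leq_pmulr.
    by rewrite -!mulnA; move: (p * q); lia.
  have -> : 6 * q * (3 * p * q) = 18 * (p * q ^ 2) by rewrite -mulnn; lia.
  by rewrite [q ^ 3]expnS [p * (q * _)]mulnCA leq_mul2r; apply/orP; right; lia.
have m_gt0 : 0 < m by [].
have le_mp : m <= p.
  rewrite -(@leq_pmul2r (q ^ 3)) ?expn_gt0 ?q_gt0 //; apply: leq_trans le_mM.
  by rewrite leq_mul2l ltnW // orbT.
have le_m2 : m * m <= q ^ 6 * p.
  rewrite -(@leq_pmul2r p) //; apply: (@leq_trans (m * m * (M * M))).
    by rewrite leq_mul2l ltnW ?orbT.
  have -> : m * m * (M * M) = (m * M) ^ 2 by rewrite -mulnn; lia.
  apply: (@leq_trans ((p * q ^ 3) ^ 2)); first by rewrite leq_sqr.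
  by apply: eq_leq; rewrite expnMn -expnM -mulnn; lia.
have E := @mul_energy_interval_le p m (- b%:R)%R (q ^ 6) q p_pr.
rewrite m_gt0 le_mp expn_gt0 q_gt0 /= -expnSr in E.
have {}E := E isT hq isT le_m2.
move=> lambda; apply: (@long_interval_cover R p A M b H l q) => //.
apply: leq_ltn_trans E _.
have M2_gt0 : 0 < M * M by rewrite muln_gt0 M_gt0.
rewrite -(ltn_pmul2r M2_gt0).
have -> : q ^ 7 * (m * m) * (M * M) = q ^ 7 * (m * M) ^ 2 by rewrite -mulnn; lia.
have -> : #|A| ^ 2 * (M * M) = (M * #|A|) ^ 2 by rewrite expnMn mulnn mulnC.
apply: (@leq_ltn_trans (q ^ 7 * (p * q ^ 3) ^ 2)); first by rewrite leq_mul2l leq_sqr le_mM orbT.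
apply: (@leq_trans ((p * q ^ 7) ^ 2)); last by rewrite leq_sqr.
have -> : q ^ 7 * (p * q ^ 3) ^ 2 = p ^ 2 * q ^ 13 by ring.
have -> : (p * q ^ 7) ^ 2 = p ^ 2 * q ^ 14 by ring.
by rewrite ltn_pmul2l ?expn_gt0 ?p_gt0 // ltn_exp2l //; lia.
Qed.

(** A quotient determines [u] because [U < p], and [u] determines [i] through [a + i = b * u]. *)
Lemma card_ratio_quotients p n U (a b x0 : 'F_p) : prime p -> n <= p -> U < p ->
  x0 != 0%R ->
  #|[set x0 / z.2.+1%:R | z : 'I_n * 'I_U in [set z : 'I_n * 'I_U | a + z.1%:R == b * z.2.+1%:R]]%R|
    = ratio_card n U a b.
Proof.
move=> p_pr lenp ltUp x0_neq0; apply: card_in_imset => -[i u] [i' u'].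
rewrite !inE /= => /eqP E /eqP E' /(mulfI x0_neq0) /invr_inj /(@natr_Fp_inj p) -/(_ p_pr).
rewrite !modn_small; first last.
- by apply: leq_ltn_trans ltUp.
- by apply: leq_ltn_trans ltUp.
case=> /val_inj Eu; rewrite -Eu -E in E' *.
by rewrite (addr_natr_inj p_pr lenp E').
Qed.

(* A single pair (i, u) representing the ratio b is used: |I| |A_b| already exceeds p. *)
Lemma fractions_cover_short_J (R : realType) k p q l M N n U V (a0 a : 'F_p) :
  prime p -> 0 < k -> 1000 * (4 ^ k * k`!) * (trunc_log 2 p).+3 <= q ->
  0 < l <= q -> p < q ^ l -> q ^ (6 * k) <= p ->
  0 < M <= p -> 0%R \notin interval a0 M -> 0%R \notin interval a N ->
  0 < U <= n -> U < p -> V < p -> q ^ 15 < V -> n + U * V <= N ->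
  V ^ k <= n * U -> n * U <= p * q ^ 5 ->
  (p * q ^ 17) ^ k.+1 <= M ^ k.+1 * (q * V ^ k) ^ k.+1 ->
  forall lambda : 'F_p, exists x y : 'I_(4 * k) -> 'F_p,
    [/\ forall i, x i \in interval a0 M, forall i, y i \in interval a N,
        forall i, y i <> 0%R & \sum_(i < 4 * k) x i / y i = lambda]%R.
Proof.
move=> p_pr k_gt0 hq hl lt_pq le_qp hM I0 J0 hU ltUp ltVp ltqV le_N leVU leUq hMV lambda.
have p_gt0 := prime_gt0 p_pr.
have ck_gt : k < 4 ^ k * k`! by apply: leq_trans (leq_pmulr _ (fact_gt0 _)); apply: ltn_expl.
set ck := 4 ^ k * k`! in hq ck_gt.
set L := (trunc_log 2 p).+3 in hq.
have hqL : 1000 * L <= q.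
  by apply: leq_trans hq; rewrite -mulnA leq_mul2l leq_pmull ?(leq_ltn_trans _ ck_gt) ?orbT.
have hqc : 1000 * ck <= q by apply: leq_trans hq; rewrite leq_pmulr.
have lt1q : 1 < q by move: hqL; rewrite /L mulnS; clear; lia.
have q_gt0 : 0 < q by apply: ltnW.
have lekq : 4 * k + 4 <= q by move: hqc ck_gt; clearbody ck; clear; lia.
have leV : 2 * k <= V.
  apply: ltnW; apply: leq_ltn_trans ltqV; apply: (@leq_trans q); first by move: lekq; clear; lia.
  by rewrite -{1}[q]expn1 leq_pexp2l.
have leL : (trunc_log 2 U).+2 <= L by rewrite /L !ltnS leqW // leq_trunc_log // ltnW.
have lekV : k <= V by apply: leq_trans leV; rewrite leq_pmull.
have [b [A [rho_b A_gt0 A_sums A_large]]] :=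
  exists_reciprocal_sumset p_pr hU ltUp ltVp lekV le_N J0.
(* Dividing by [q ^ 7] pays for the factor of at most [3 * q ^ 5] from the wrap-around modulo [p],
   the constant 16 and the logarithm. *)
pose T := V ^ k %/ q ^ 7.
have q7_gt0 : 0 < q ^ 7 by rewrite expn_gt0 q_gt0.
have leT : T * q ^ 7 <= V ^ k by apply: leq_trunc_div.
have ltT : V ^ k < T.+1 * q ^ 7 by apply: ltn_ceil.
have leTA : T <= (2 * k + 1) * #|A|.
  apply: A_large.
    rewrite -(@leq_pmul2r q) //; apply: (@leq_trans (T * q ^ 7)).
      by rewrite leq_mul2l -{1}[q]expn1 leq_pexp2l ?orbT.
    apply: leq_trans leT _; apply: leq_trans (expn_le_bin leV) _.
    rewrite [_ * q]mulnC leq_mul2r; apply/orP; right; apply: leq_trans hqc.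
    rewrite -[2 ^ k * _]mul1n; apply: leq_mul => //.
    by rewrite leq_mul2r leq_exp2r ?orbT.
  apply: leq_trans leVU; apply: leq_trans leT; rewrite mulnC leq_mul2l; apply/orP; right.
  have leK : ((2 * n * U) %/ p).+1 <= 3 * q ^ 5.
    have : (2 * n * U) %/ p <= 2 * q ^ 5.
      rewrite -(mulnK (2 * q ^ 5) p_gt0); apply: leq_div2r.
      by rewrite -mulnA -[2 * q ^ 5 * p]mulnA leq_mul2l [q ^ 5 * _]mulnC leUq orbT.
    have : 0 < q ^ 5 by rewrite expn_gt0 q_gt0.
    by move: (_ %/ p) (q ^ 5) => x y; clear; lia.
  apply: (@leq_trans (16 * (3 * q ^ 5) * L)).
    by apply: leq_mul => //; rewrite leq_mul2l leK orbT.
  have -> : 16 * (3 * q ^ 5) * L = q ^ 5 * (48 * L) by ring.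
  rewrite -[7]/(5 + 2) expnD leq_mul2l; apply/orP; right.
  apply: (@leq_trans q); first by move: hqL; clear; lia.
  by rewrite -{1}[q]expn1 leq_pexp2l.
have leVA : V ^ k <= q ^ 8 * #|A|.
  apply: ltnW; apply: leq_trans ltT _; rewrite [T.+1 * _]mulnC [q ^ 8]expnSr -mulnA leq_mul2l.
  apply/orP; right; apply: (@leq_trans ((2 * k + 2) * #|A|)).
    by move: leTA A_gt0; move: #|A| => y; clear; lia.
  by rewrite leq_mul2r; apply/orP; right; move: lekq; clear; lia.
have leVk : V <= V ^ k by rewrite -{1}[V]expn1 leq_pexp2l // (leq_ltn_trans _ ltqV).
pose A' := A :\ 0%R.
have leA : #|A| <= 2 * #|A'|.
  have : #|A| <= 1 + #|A'| by rewrite (cardsD1 0%R A) leq_add2r leq_b1.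
  have : 1 < #|A|.
    rewrite ltnNge; apply/negP => leA1.
    have : q ^ 15 < q ^ 8.
      apply: leq_trans ltqV _; apply: leq_trans leVk _; apply: leq_trans leVA _.
      by rewrite -[X in _ <= X]muln1 leq_mul2l leA1 orbT.
    by rewrite ltn_exp2l.
  by move: #|A| #|A'| => x y; clear; lia.
have leMA : p * q ^ 7 <= M * #|A'|.
  rewrite -(@leq_pmul2l (q ^ 10)) ?expn_gt0 ?q_gt0 //.
  have -> : q ^ 10 * (p * q ^ 7) = p * q ^ 17 by ring.
  rewrite -(leq_exp2r _ _ (ltn0Sn k)); apply: leq_trans hMV _.
  rewrite -expnMn leq_exp2r // [q ^ 10 * _]mulnCA leq_mul2l; apply/orP; right.
  apply: (@leq_trans (q * (q ^ 8 * (2 * #|A'|)))).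
    rewrite leq_mul2l; apply/orP; right; apply: leq_trans leVA _.
    by rewrite leq_mul2l leA orbT.
  have -> : q * (q ^ 8 * (2 * #|A'|)) = 2 * (q ^ 9 * #|A'|) by ring.
  by rewrite [q ^ 10]expnS -[q * _ * _]mulnA leq_mul2r lt1q orbT.
have A'0 : 0%R \notin A' by rewrite !inE eqxx.
have [i [u Eb]] : exists i u, (a + (i : 'I_n)%:R = b * (u : 'I_U).+1%:R)%R.
  have nU_gt0 : 0 < n * U by case/andP: hU => h1 h2; rewrite muln_gt0 h1 (leq_trans h1).
  have : 0 < ratio_card n U a b.
    by rewrite lt0n; apply/eqP => r0; move: rho_b; rewrite r0 muln0 leqNgt nU_gt0.
  by rewrite card_gt0 => /set0Pn[[i u]]; rewrite inE /= => /eqP; exists i, u.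

have u_neq0 : (u.+1%:R != 0 :> 'F_p)%R.
  by apply: natr_Fp_neq0 => //=; apply: leq_ltn_trans ltUp.
have q6 : q ^ 6 <= p by apply: leq_trans le_qp; rewrite leq_pexp2l // leq_pmulr.
(* All numerators will be divided by the same [u], so the target is multiplied by it. *)
have [|x [al [xI alA sum_eq]]] := @interval_products_cover R p q l M a0 A' p_pr _ hl lt_pq q6
  hM I0 A'0 leMA (lambda * u.+1%:R)%R; first by rewrite -/L; move: hqL; clear; lia.
have [||x' [y' [x'I y'J y'0 sum_eq']]] := @assemble_fractions p k (interval a0 M) a b N n U V
    (fun j => x j / u.+1%:R)%R al p_pr ltUp le_N J0.
- by move=> j; exists (x j), i, u.
- by move=> j; apply: A_sums; have := alA j; rewrite in_setD1 => /andP[].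
exists x', y'; split=> //; rewrite sum_eq' -[RHS](mulfK u_neq0) -sum_eq big_distrl /=.
by apply: eq_bigr => j _; rewrite mulrAC.
Qed.

(* A_b fills F_p up to a factor q ^ 2, and the many u with b u in J play the role of the
   interval I, of which only the point x0 is used. *)
Lemma fractions_cover_long_J (R : realType) k p q N n U V (x0 a : 'F_p) (I : {set 'F_p}) :
  prime p -> 0 < k -> 1000 * (4 ^ k * k`!) * (trunc_log 2 p).+3 <= q ->
  x0 \in I -> x0 != 0%R -> 0%R \notin interval a N ->
  0 < U <= n -> U < p -> n <= p -> V < p -> 2 * k <= V -> n + U * V <= N ->
  p < (2 * V) ^ k -> p * q ^ 5 < n * U ->
  forall lambda : 'F_p, exists x y : 'I_(4 * k) -> 'F_p,
    [/\ forall i, x i \in I, forall i, y i \in interval a N,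
        forall i, y i <> 0%R & \sum_(i < 4 * k) x i / y i = lambda]%R.
Proof.
move=> p_pr k_gt0 hq x0I x0_neq0 J0 hU ltUp lenp ltVp leV le_N ltpV ltUq lambda.
have p_gt0 := prime_gt0 p_pr.
have ck_gt : k < 4 ^ k * k`! by apply: leq_trans (leq_pmulr _ (fact_gt0 _)); apply: ltn_expl.
set ck := 4 ^ k * k`! in hq ck_gt.
set L := (trunc_log 2 p).+3 in hq.
have hqL : 1000 * L <= q.
  by apply: leq_trans hq; rewrite -mulnA leq_mul2l leq_pmull ?(leq_ltn_trans _ ck_gt) ?orbT.
have hqc : 1000 * ck <= q by apply: leq_trans hq; rewrite leq_pmulr.
have lt1q : 1 < q by move: hqL; rewrite /L mulnS; clear; lia.
have q_gt0 : 0 < q by apply: ltnW.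
have lekq : 4 * k + 4 <= q by move: hqc ck_gt; clearbody ck; clear; lia.
have leL : (trunc_log 2 U).+2 <= L by rewrite /L !ltnS leqW // leq_trunc_log // ltnW.
have lekV : k <= V by apply: leq_trans leV; rewrite leq_pmull.
have [b [A [rho_b A_gt0 A_sums A_large]]] :=
  exists_reciprocal_sumset p_pr hU ltUp ltVp lekV le_N J0.
(* Here [p * q ^ 5 < n * U], so the number of popular ratios is of order [p] up to the logarithm,
   which [q] absorbs. *)
pose T := p %/ q.
have leT : T * q <= p by apply: leq_trunc_div.
have ltT : p < T.+1 * q by apply: ltn_ceil.
have leTA : T <= (2 * k + 1) * #|A|.
  apply: A_large.
    rewrite -(@leq_pmul2r q) //; apply: leq_trans leT _; apply: leq_trans (ltnW ltpV) _.
    rewrite expnMn; apply: leq_trans (leq_mul (leqnn _) (expn_le_bin leV)) _.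
    rewrite mulnA [_ * q]mulnC leq_mul2r; apply/orP; right; apply: leq_trans hqc.
    by rewrite mulnA -expnMn -/ck leq_pmull.
  rewrite -(@leq_pmul2l p) //.
  have leK : p * ((2 * n * U) %/ p).+1 <= 3 * (n * U).
    rewrite mulnS addnC [p * _]mulnC; apply: (@leq_trans (2 * n * U + p)).
      by rewrite leq_add2r leq_trunc_div.
    have : p <= n * U.
      by apply: leq_trans (ltnW ltUq); rewrite leq_pmulr // expn_gt0 q_gt0.
    by rewrite -[2 * n * U]mulnA; move: (n * U); clear; lia.
  set K := (_ %/ p).+1 in leK *; set Lu := (trunc_log 2 U).+2 in leL *.
  have -> : p * (16 * K * Lu * T) = 16 * (p * K) * (Lu * T) by ring.
  apply: (@leq_trans (16 * (3 * (n * U)) * (L * T))).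
    by apply: leq_mul; rewrite ?leq_mul2l ?leK ?leq_mul2r ?leL ?orbT.
  have -> : 16 * (3 * (n * U)) * (L * T) = (48 * L * T) * (n * U) by ring.
  rewrite leq_mul2r; apply/orP; right; apply: leq_trans leT.
  by rewrite mulnC leq_mul2l; apply/orP; right; move: hqL; clear; lia.
have lepA : p < q ^ 2 * #|A|.
  apply: leq_trans ltT _; rewrite mulnC -mulnn -mulnA leq_mul2l; apply/orP; right.
  apply: (@leq_trans ((2 * k + 2) * #|A|)).
    by move: leTA A_gt0; move: #|A| => y; clear; lia.
  by rewrite leq_mul2r; apply/orP; right; move: lekq; clear; lia.
set rho := ratio_card n U a b in rho_b.
have lt_rho : q ^ 5 < 2 * rho.
  rewrite -(@ltn_pmul2l p) //; apply: leq_trans ltUq _.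
  by rewrite mulnA [p * 2]mulnC.
pose X : {set 'F_p} :=
  [set x0 / z.2.+1%:R | z : 'I_n * 'I_U in [set z : 'I_n * 'I_U | a + z.1%:R == b * z.2.+1%:R]]%R.
have cardX : #|X| = rho by apply: card_ratio_quotients.
have X0 : 0%R \notin X.
  apply/imsetP => -[z _] /esym/eqP; rewrite mulf_eq0 invr_eq0 (negPf x0_neq0) /=.
  by apply/negP; apply: natr_Fp_neq0 => //=; apply: leq_ltn_trans ltUp.
have [|xi [al [xiX alA sum_eq]]] :=
  four_products_cover (X := X) (A := A) (Fp_char_add_character R p_pr) _ lambda.
  (* The cubic energy bound suffices: it leaves [p ^ 2 < #|A| ^ 2 * rho], which follows from
     [p < q ^ 2 * #|A|] and [q ^ 5 < 2 * rho]. *)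
  rewrite card_Fp //; apply: (@leq_ltn_trans (p ^ 2 * rho ^ 3)).
    by rewrite leq_mul2l -cardX mul_energy_le_cube // orbT.
  rewrite cardX [rho ^ 4]expnS mulnA ltn_pmul2r; last first.
    by rewrite expn_gt0; move: lt_rho; case: (rho).
  rewrite -(@ltn_pmul2l 2) //; apply: (@leq_ltn_trans (q * p ^ 2)).
    by rewrite leq_mul2r lt1q orbT.
  apply: (@leq_ltn_trans (q ^ 5 * #|A| ^ 2)).
    rewrite (expnS q 4) -mulnA leq_mul2l (expnM q 2 2) -expnMn leq_sqr.
    by rewrite (ltnW lepA) orbT.
  by rewrite [#|A| ^ 2 * _]mulnC mulnA ltn_pmul2r // expn_gt0 A_gt0.
have [||x' [y' [x'I y'J y'0 sum_eq']]] := @assemble_fractions p k I a b N n U V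
    xi al p_pr ltUp le_N J0.
- move=> j; have /imsetP[[i u]] := xiX j; rewrite inE /= => /eqP Eb Exi.
  by exists x0, i, u.
- by move=> j; apply: A_sums.
by exists x', y'; split=> //; rewrite sum_eq'.
Qed.

(** With [V] about [N ^ (2 / (k + 1))] and [U * V] about [N], the quantities [V ^ k] and [n * U] are
    comparable. If [n * U] is well above [p], then [V] is lowered until [V ^ k] is comparable to
    [p]. *)
Lemma fractions_cover (R : realType) k p q l M N (a0 a : 'F_p) :
  prime p -> 0 < k -> 1000 * (4 ^ k * k`!) * (trunc_log 2 p).+3 <= q ->
  0 < l <= q -> p < q ^ l -> q ^ (6 * k) <= p ->
  0 < M <= p -> N <= p -> 0%R \notin interval a0 M -> 0%R \notin interval a N ->
  p ^ k.+1 * q ^ (18 * k * k.+1) <= M ^ k.+1 * N ^ (2 * k) ->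
  forall lambda : 'F_p, exists x y : 'I_(4 * k) -> 'F_p,
    [/\ forall i, x i \in interval a0 M, forall i, y i \in interval a N,
        forall i, y i <> 0%R & \sum_(i < 4 * k) x i / y i = lambda]%R.
Proof.
move=> p_pr k_gt0 hq hl lt_pq le_qp hM leNp I0 J0 h3.
have p_gt0 := prime_gt0 p_pr; have [M_gt0 leMp] := andP hM.
have hqc : 1000 * (4 ^ k * k`!) <= q by apply: leq_trans hq; rewrite leq_pmulr.
have ck : 4 ^ k <= 4 ^ k * k`! by rewrite leq_pmulr // fact_gt0.
have le2k : 2 ^ k <= 4 ^ k by rewrite leq_exp2r.
have ltk : k < 2 ^ k by apply: ltn_expl.
have hq2 : 1000 * 2 ^ k <= q by move: hqc ck le2k; move: (2 ^ k) (4 ^ k) (_ * _`!); clear; lia.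
have lt1q : 1 < q by move: hq2 ltk; clear; move: (2 ^ k); lia.
have q_gt0 : 0 < q by apply: ltnW.
have k2_gt0 : 0 < 2 * k by rewrite muln_gt0.
have leqN : q ^ (9 * k.+1) <= N.
  rewrite -(leq_exp2r _ _ k2_gt0) -expnM.
  rewrite -(@leq_pmul2l (p ^ k.+1)) ?expn_gt0 ?p_gt0 //.
  have -> : 9 * k.+1 * (2 * k) = 18 * k * k.+1 by ring.
  apply: leq_trans h3 _; rewrite leq_mul2r leq_exp2r // leMp orbT //.
(* Half of [4 * n0] is for the numerators [a + i] of the ratios, the other half for the shifts
   [u * v]. *)
pose n0 := N %/ 4.
have le4n0 : 4 * n0 <= N by rewrite mulnC leq_trunc_div.
have leN8 : N <= 8 * n0.
  have : N < 4 * n0.+1 by rewrite mulnC ltn_ceil.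
  have : q <= N by apply: leq_trans leqN; rewrite -{1}[q]expn1 leq_pexp2l.
  have : 4 <= q by move: hq2 ltk; clear; move: (2 ^ k); lia.
  by clear; lia.
have le8q : 8 <= q by move: hq2 ltk; clear; move: (2 ^ k); lia.
have leqn0 : q ^ (9 * k + 8) <= n0.
  rewrite -(@leq_pmul2l q) // -expnS.
  have -> : (9 * k + 8).+1 = 9 * k.+1 by ring.
  by apply: leq_trans leqN _; apply: leq_trans leN8 _; rewrite leq_mul2r le8q orbT.
have n0_gt0 : 0 < n0 by apply: leq_trans leqn0; rewrite expn_gt0 q_gt0.
have [V /andP[leV ltV]] := exists_root (n0 ^ 2) (ltn0Sn k).
have V_gt0 : 0 < V.
  rewrite lt0n; apply/eqP => V0; move: ltV; rewrite V0 exp1n ltnS leqNgt.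
  by rewrite expn_gt0 n0_gt0.
have {}ltV : n0 ^ 2 < (2 * V) ^ k.+1.
  by apply: leq_trans ltV _; rewrite leq_exp2r // mul2n -addnn; move: V_gt0; clear; lia.
have ltqV : q ^ 15 < V.
  have : q ^ 16 < 2 * V.
    rewrite -(ltn_exp2r _ _ (ltn0Sn k)); apply: leq_ltn_trans ltV.
    apply: (@leq_trans ((q ^ (9 * k + 8)) ^ 2)); last by rewrite leq_sqr.
    by rewrite -!expnM leq_pexp2l //; clear; lia.
  rewrite expnS => h; have : q * q ^ 15 < q * V.
    by apply: leq_trans h _; rewrite leq_mul2r lt1q orbT.
  by rewrite ltn_pmul2l.
have leVn0 : V <= n0.
  rewrite -leq_sqr; apply: leq_trans leV; rewrite leq_pexp2l //.
pose n := 2 * n0; pose U := n %/ V.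
have leUV : U * V <= n by apply: leq_trunc_div.
have U_ge1 : 0 < U by rewrite divn_gt0 // /n mul2n -addnn (leq_trans leVn0) ?leq_addr.
have leUn : U <= n by apply: leq_div.
have hU : 0 < U <= n by rewrite U_ge1.
have lt_np : n < p.
  by apply: leq_trans leNp; apply: leq_trans le4n0; rewrite /n; move: n0_gt0; clear; lia.
have ltUp : U < p by apply: leq_ltn_trans lt_np.
have ltVp : V < p by apply: leq_ltn_trans leVn0 _; apply: leq_ltn_trans lt_np; rewrite /n leq_pmull.
have le_N : n + U * V <= N.
  by apply: leq_trans le4n0; rewrite /n in leUV *; move: leUV; move: (U * V); clear; lia.
have n0UV : n0 <= U * V.
  have : n < U.+1 * V by rewrite ltn_ceil.
  by rewrite mulSn /n; move: leVn0; move: (U * V); clear; lia.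
have leVU : V ^ k <= n * U.
  rewrite -(@leq_pmul2r V) // -expnSr -mulnA; apply: leq_trans leV _; rewrite -mulnn.
  by apply: leq_mul n0UV; rewrite /n leq_pmull.
have [leUq|ltUq] := leqP (n * U) (p * q ^ 5).
  apply: (@fractions_cover_short_J R k p q l M N n U V) => //.
  apply: (@leq_trans (p ^ k.+1 * q ^ (18 * k * k.+1))).
    rewrite expnMn leq_mul2l -expnM leq_pexp2l ?orbT // leq_mul2r; apply/orP; right.
    by move: k_gt0; clear; lia.
  apply: leq_trans h3 _; rewrite leq_mul2l; apply/orP; right.
  apply: (@leq_trans ((8 * n0) ^ (2 * k))); first by rewrite leq_exp2r.
  rewrite expnM expnMn; apply: (@leq_trans ((64 * (2 * V) ^ k.+1) ^ k)).
    by rewrite leq_exp2r // leq_mul2l ltnW.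
  apply: (@leq_trans ((64 * (2 * V) ^ k) ^ k.+1)).
    rewrite !expnMn -!expnM [k.+1 * k]mulnC leq_mul2r leq_pexp2l ?orbT //.
  rewrite leq_exp2r // expnMn mulnA leq_mul2r; apply/orP; right.
  by move: hq2; move: (2 ^ k); clear; lia.
(* [V2] replaces [V]. It will turn out smaller than [V], so the new [U2] is at least [U] and
   [p * q ^ 5 < n * U2] persists. *)
have [V2 /andP[leV2 ltV2]] := exists_root p k_gt0.
have V2_gt0 : 0 < V2.
  by rewrite lt0n; apply/eqP => V0; move: ltV2; rewrite V0 exp1n ltnNge p_gt0.
have {}ltV2 : p < (2 * V2) ^ k.
  by apply: leq_trans ltV2 _; rewrite leq_exp2r // mul2n -addnn; move: V2_gt0; clear; lia.
have ltpV : p < V ^ k.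
  have h : p * q ^ 5 * V < 4 * (2 * V) ^ k.+1.
    apply: (@leq_ltn_trans (4 * n0 ^ 2)); last by rewrite ltn_pmul2l.
    apply: (@leq_trans (n * U * V)); first by rewrite leq_mul2r ltnW ?orbT.
    have -> : 4 * n0 ^ 2 = n * n by rewrite /n; ring.
    by rewrite -mulnA leq_mul2l leUV orbT.
  have : p * q ^ 5 < 8 * 2 ^ k * V ^ k.
    rewrite -(ltn_pmul2r V_gt0); apply: leq_trans h _; apply: eq_leq.
    by rewrite expnS expnMn; ring.
  move=> h2; have : q * p < q * V ^ k.
    apply: leq_ltn_trans (leq_trans h2 _).
      rewrite mulnC leq_mul2l -{1}[q]expn1 leq_pexp2l ?orbT //.
    by rewrite leq_mul2r; apply/orP; right; move: hq2; move: (2 ^ k); clear; lia.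
  by rewrite ltn_pmul2l.
have ltV2V : V2 < V by rewrite -(ltn_exp2r _ _ k_gt0); apply: leq_ltn_trans ltpV.
pose U2 := n %/ V2.
have leUU2 : U <= U2 by apply: leq_div2l => //; apply: ltnW.
have leV2k : 2 * k <= V2.
  have : q < 2 * V2.
    rewrite -(ltn_exp2r _ _ k_gt0); apply: leq_ltn_trans ltV2; apply: leq_trans le_qp.
    by rewrite leq_pexp2l // leq_pmull.
  by move: hq2 ltk; move: (2 ^ k); clear; lia.
have hU2 : 0 < U2 <= n by rewrite (leq_trans U_ge1) //=; apply: leq_div.
have a0I : a0 \in interval a0 M by have := mem_interval a0 M_gt0; rewrite mulr0n addr0.
apply: (@fractions_cover_long_J R k p q N n U2 V2 a0 a) => //.
- by apply: contraNneq I0 => <-.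
- by apply: leq_ltn_trans lt_np; case/andP: hU2.
- exact: ltnW.
- exact: ltn_trans ltVp.
- apply: leq_trans le4n0; have : U2 * V2 <= n by apply: leq_trunc_div.
  by rewrite /n; move: (U2 * V2); clear; lia.
by apply: leq_trans ltUq _; rewrite leq_mul2l leUU2 orbT.
Qed.

(** * From real exponents to integer inequalities *)

Lemma linear_le_exp2 D n : 4 * D <= n -> D * n.+1 <= 2 ^ n.
Proof.
move=> leDn; set j := n %/ 2.
have lt_n : n < j.+1 * 2 by apply: ltn_ceil.
have le_j : j * 2 <= n by apply: leq_trunc_div.
apply: (@leq_trans (2 ^ (j * 2))); last by rewrite leq_exp2l.
rewrite expnM; apply: (@leq_trans (j.+1 ^ 2)); last by rewrite leq_sqr ltn_expl.
rewrite -mulnn; apply: (@leq_trans (D * (j.+1 * 2))); first by rewrite leq_mul2l lt_n orbT.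
rewrite mulnCA leq_mul2l; apply/orP; right; move: lt_n leDn; clear; lia.
Qed.

(** [q] is the integer part of the [s]-th root of [p]: a small power of [p], yet eventually larger
    than any multiple of its logarithm. Moreover [p < (2 * q) ^ s <= q ^ (2 * s)]. *)
Lemma exists_log_scale (c s : nat) : 0 < s ->
  exists p0, forall p, p0 < p -> exists q,
    [/\ c * (trunc_log 2 p).+3 <= q, 0 < 2 * s <= q, p < q ^ (2 * s) & q ^ s <= p].
Proof.
move=> s_gt0; pose D := c * (2 * s + 3); pose Q := 2 ^ (4 * D) + 2 * s.
exists (Q ^ s) => p ltp; have [q /andP[leqp ltpq]] := exists_root p s_gt0.
have leQq : Q <= q by rewrite -ltnS -(ltn_exp2r _ _ s_gt0); apply: ltn_trans ltpq.
have le2s : 2 * s <= q by apply: leq_trans leQq; apply: leq_addl.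
have q_gt1 : 1 < q by apply: leq_trans le2s; move: s_gt0; clear; lia.
have ltpq2 : p < (2 * q) ^ s.
  by apply: leq_trans ltpq _; rewrite leq_exp2r // mul2n -addnn; move: q_gt1; clear; lia.
exists q; split=> //.
- set n := trunc_log 2 q.
  have q_gt0 : 0 < q by apply: ltnW.
  have le_n : 2 ^ n <= q by apply: trunc_logP.
  have lt_n : q < 2 ^ n.+1 by apply: trunc_log_ltn.
  have leDn : 4 * D <= n.
    by apply: trunc_log_max => //; apply: leq_trans leQq; apply: leq_addr.
  have p_gt0 : 0 < p by apply: leq_ltn_trans ltp.
  have le_lg : trunc_log 2 p <= s * n.+2.
    rewrite -(@leq_exp2l 2) //; apply: leq_trans (trunc_logP _ p_gt0) _ => //.
    apply: leq_trans (ltnW ltpq2) _; rewrite [s * _]mulnC expnM leq_exp2r // expnS.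
    by rewrite leq_mul2l ltnW.
  apply: leq_trans le_n; apply: leq_trans (linear_le_exp2 leDn).
  rewrite /D -mulnA leq_mul2l; apply/orP; right.
  have : s * n.+2 <= 2 * s * n.+1 by rewrite -mulnA mulnCA leq_mul2l; apply/orP; right; clear; lia.
  by move: le_lg; rewrite mulnDl; move: (trunc_log 2 p) (s * _) (2 * s * _); clear; lia.
- by rewrite muln_gt0 s_gt0.
apply: leq_trans ltpq2 _; rewrite expnM leq_exp2r // -mulnn leq_mul2r q_gt1 orbT //.
Qed.

(** Taking [k.+1]-th powers clears the rational exponent, and [p ^ eps] is at least [q ^ (s * eps)],
    hence at least [q ^ (18 * k + 1)]. *)
Lemma powR_lt_expn_le (R : realType) (k s p q x y : nat) (eps : R) :
  (0 < k) -> (0 < q) -> q ^ s <= p -> ((18 * k + 1)%:R <= s%:R * eps)%R -> (0 < eps)%R ->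
  (p%:R `^ (1 + eps) < x%:R * y%:R `^ ((2 * k)%:R / (k + 1)%:R))%R ->
  p ^ k.+1 * q ^ ((18 * k + 1) * k.+1) <= x ^ k.+1 * y ^ (2 * k).
Proof.
move=> k_gt0 q_gt0 leqp les eps_gt0 hyp.
have p_gt0 : 0 < p by apply: leq_trans leqp; rewrite expn_gt0 q_gt0.
have p_gt0R : (0 < p%:R :> R)%R by rewrite ltr0n.
have le_eps : ((q ^ (18 * k + 1))%:R <= p%:R `^ eps :> R)%R.
  apply: (@le_trans _ _ ((q ^ s)%:R `^ eps)%R); last first.
    by apply: ge0_ler_powR; rewrite ?nnegrE ?ler0n ?ler_nat // ltW.
  rewrite !natrX -!powR_mulrn ?ler0n // -powRrM.
  by apply: ler_powR; rewrite ?ler1n.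
have {}hyp : ((p * q ^ (18 * k + 1))%:R <= x%:R * y%:R `^ ((2 * k)%:R / (k + 1)%:R) :> R)%R.
  apply: le_trans (ltW hyp); rewrite powRD; last by rewrite (gt_eqF p_gt0R) implybT.
  rewrite powRr1 ?ler0n // natrM; apply: ler_wpM2l => //; exact: ler0n.
have -> : p ^ k.+1 * q ^ ((18 * k + 1) * k.+1) = (p * q ^ (18 * k + 1)) ^ k.+1.
  by rewrite expnMn -expnM.
rewrite -(ler_nat R) natrX; apply: le_trans (lerXn2r k.+1 _ _ hyp) _; rewrite ?nnegrE ?ler0n //.
  by rewrite mulr_ge0 ?ler0n ?powR_ge0.
rewrite exprMn [X in (_ <= X)%R]natrM natrX; apply: ler_wpM2l; first by rewrite exprn_ge0 ?ler0n.
rewrite -powR_mulrn ?powR_ge0 // -powRrM -[k.+1]addn1 divfK ?pnatr_eq0 ?addn1 //.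
by rewrite powR_mulrn ?ler0n // natrX.
Qed.

Local Open Scope ring_scope.

Theorem theorem3 (R : realType) (k : nat) (hk : (0 < k)%N)
    (eps : R) (heps : 0 < eps) :
  exists p0 : nat, forall p : nat, prime p -> (p0 < p)%N ->
  forall I J : {set 'F_p}, is_nonzero_interval I -> is_nonzero_interval J ->
    #|I|%:R * #|J|%:R `^ ((2 * k)%:R / (k + 1)%:R) > p%:R `^ (1 + eps) ->
  forall lambda : 'F_p,
    exists x y : 'I_(4 * k) -> 'F_p,
      [/\ forall i, x i \in I,
          forall i, y i \in J,
          forall i, y i <> 0 &
          \sum_(i < 4 * k) x i / y i = lambda].
Proof.
(* The first bound yields [q ^ (6 * k) <= p]; the second makes [p ^ eps] exceed the powers of [q]
   lost on the way. *)
have [s [s_ge s_eps]] : exists s, (6 * k <= s)%N /\ (18 * k + 1)%:R <= s%:R * eps.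
  pose t := Num.bound ((18 * k + 1)%:R / eps).
  exists (maxn (6 * k) t); split; first exact: leq_maxl.
  rewrite -ler_pdivrMr //; apply: (@le_trans _ _ t%:R); last by rewrite ler_nat leq_maxr.
  by apply: ltW; apply: archi_boundP; rewrite divr_ge0 ?ler0n // ltW.
have s_gt0 : (0 < s)%N by apply: leq_trans s_ge; rewrite muln_gt0.
have [p0 hp0] := exists_log_scale (1000 * (4 ^ k * k`!)) s_gt0.
exists p0 => p p_pr /hp0[q [hq hl lt_pq leqp]] I J.
move=> /(nonzero_subinterval p_pr)[a0 [M [hM cardI subI I0]]].
move=> /(nonzero_subinterval p_pr)[a [N [hN cardJ subJ J0]]] hyp lambda.
have q_gt0 : (0 < q)%N by case/andP: hl => h1 h2; apply: leq_trans h2.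
have hqp : (q ^ (6 * k) <= p)%N by apply: leq_trans leqp; rewrite leq_pexp2l.
have leNp : (N <= p)%N by case/andP: hN.
have ge27 : (27 <= q)%N.
  apply: leq_trans hq; apply: (@leq_trans (1000 * (4 ^ k * k`!))); last by rewrite leq_pmulr.
  by rewrite -[X in (X <= _)%N]muln1; apply: leq_mul; rewrite // muln_gt0 expn_gt0 fact_gt0.
(* Passing to subintervals without 0 costs [3 ^ (k.+1 + 2 * k)], at most [27 ^ k.+1], which the
   spare factor [q ^ k.+1] absorbs. *)
have h3 : (p ^ k.+1 * q ^ (18 * k * k.+1) <= M ^ k.+1 * N ^ (2 * k))%N.
  rewrite -(@leq_pmul2l (q ^ k.+1)) ?expn_gt0 ?q_gt0 // mulnCA -expnD.
  have -> : (k.+1 + 18 * k * k.+1 = (18 * k + 1) * k.+1)%N by ring.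
  apply: leq_trans (powR_lt_expn_le hk q_gt0 leqp s_eps heps hyp) _.
  apply: (@leq_trans ((3 * M) ^ k.+1 * (3 * N) ^ (2 * k))).
    by apply: leq_mul; rewrite leq_exp2r // muln_gt0.
  rewrite !expnMn mulnACA leq_mul2r; apply/orP; right; rewrite -expnD.
  apply: (@leq_trans (27 ^ k.+1)); last by rewrite leq_exp2r.
  by rewrite -[27%N]/(3 ^ 3)%N -expnM leq_exp2l //; lia.
have [x [y [xI yJ y0 sum_eq]]] :=
  @fractions_cover R k p q (2 * s) M N a0 a p_pr hk hq hl lt_pq hqp hM leNp I0 J0 h3 lambda.
by exists x, y; split=> // i; [apply: (subsetP subI) | apply: (subsetP subJ)].
Qed.
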